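(* Let $J$ be an integrable and symmetric kernel on $\mathbb{Z}^d$ such that there exist constants $0<a<A<\infty$ with $$0 < aJ(x+e_i) \leq J(x) \leq A J(x+e_i)$$ for all $i\in \{1,\ldots,d\}$ and all $x \in \mathbb{Z}^d$ with $\|x\|$ large enough. Define the kernel $\overline{J}$ by $$\overline{J}(x)= \begin{cases} J(x) +1 & \text{ if } \|x\| = 1\\ J(x) & \text{ else. } \end{cases}$$ Then $\beta_c(\overline{J}) < \beta_c(J)$.
   Context: $\|\cdot\|$ is the Euclidean norm, $e_i$ the $i$-th standard unit vector, $\mathbf 0$ the origin. A kernel is a function $J:\mathbb{Z}^d\to[0,\infty)$ (the value at $\mathbf 0$ being irrelevant). It is symmetric if $J(x)$ is invariant under sign flips and permutations of the coordinates of $x$, and integrable if $\sum_{x\in\mathbb{Z}^d} J(x)<\infty$. Under $\mathbb{P}_{\beta,J}$, each edge $\{x,y\}$ with $x\neq y\in\mathbb{Z}^d$ is open with probability $1-e^{-\beta J(x-y)}$, independently of all other edges. $K_x$ is the open cluster (connected component of the graph of open edges) containing $x$, and $\beta_c(J)=\inf\{\beta\ge0:\mathbb{P}_{\beta,J}(|K_{\mathbf 0}|=\infty)>0\}$.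
   Formalization: For d = 1 the formal statement additionally assumes β_c(J) < ∞: otherwise, e.g. for J(x) = 2^{-|x|} on Z, both critical values are +∞ and the strict inequality fails. *)

(* Defs.v *)
From HB Require Import structures.
From mathcomp Require Import all_boot all_order all_algebra perm finmap.
From mathcomp Require Import ring lra.
From mathcomp Require Import all_classical all_reals all_analysis.
Set Implicit Arguments.
Unset Strict Implicit.
Unset Printing Implicit Defensive.
Import Order.TTheory GRing.Theory Num.Theory.
Local Open Scope classical_set_scope.
Local Open Scope ring_scope.

Definition unit_vec (d : nat) (i : 'I_d) : 'rV[int]_d := delta_mx 0 i.

Definition enorm (R : realType) (d : nat) (x : 'rV[int]_d) : R :=
  Num.sqrt (\sum_(i < d) (x 0 i)%:~R ^+ 2).

Definition flip (d : nat) (i : 'I_d) (x : 'rV[int]_d) : 'rV[int]_d :=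
  \row_j (if j == i then - x 0 j else x 0 j).

Definition symmetric_kernel (R : realType) (d : nat) (J : 'rV[int]_d -> R) : Prop :=
  (forall (s : 'S_d) (x : 'rV[int]_d), J (col_perm s x) = J x) /\
  (forall (i : 'I_d) (x : 'rV[int]_d), J (flip i x) = J x).

Definition integrable_kernel (R : realType) (d : nat) (J : 'rV[int]_d -> R) : Prop :=
  (\esum_(x in [set: 'rV[int]_d]) (J x)%:E < +oo)%E.

Definition edge (d : nat) := {e : {fset 'rV[int]_d} | #|` e| == 2%N}.

Definition cylinders (I : Type) : set (set (I -> bool)) :=
  [set A | exists i, A = [set w : I -> bool | w i]].

(* carries the product sigma-algebra, generated by the coordinates *)
Definition config (I : Type) := g_sigma_algebraType (@cylinders I).

Section config_instances.
Variable I : Type.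
HB.instance Definition _ := Measurable.on (config I).
End config_instances.

Definition is_open (d : nat) (w : config (edge d)) (x y : 'rV[int]_d) : bool :=
  oapp (w : edge d -> bool) false (insub [fset x; y]%fset).

Definition open_cluster (d : nat) (w : config (edge d)) (x : 'rV[int]_d) : set ('rV[int]_d) :=
  [set y | exists2 p : seq ('rV[int]_d), path (is_open w) x p & last x p = y].

(* The edges {x, y}, for (x, y) in any finite list of pairs naming pairwise
   distinct edges, are simultaneously open with the product probability; as
   these events form a pi-system, this determines P. *)
Definition percolation_law (R : realType) (d : nat) (beta : R) (J : 'rV[int]_d -> R)
    (P : probability (config (edge d)) R) : Prop :=
  forall s : seq ('rV[int]_d * 'rV[int]_d),
    all (fun e => e.1 != e.2) s ->
    uniq [seq [fset e.1; e.2]%fset | e <- s] ->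
    P [set w | all (fun e => is_open w e.1 e.2) s] =
    (\prod_(e <- s) (1 - expR (- (beta * J (e.1 - e.2)))))%:E.

(* [percolation_law beta J] has exactly one element up to equality on measurable
   sets when 0 <= beta and J is a nonnegative symmetric kernel: see
   [percolation_law_exists] and [percolation_law_unique] below. *)
Definition percolation (R : realType) (d : nat) (beta : R) (J : 'rV[int]_d -> R) :
    probability (config (edge d)) R :=
  xget (\d_(point : config (edge d)) : probability (config (edge d)) R) [set P | percolation_law beta J P].

(* +oo when there is no percolation at any beta *)
Definition beta_c (R : realType) (d : nat) (J : 'rV[int]_d -> R) : \bar R :=
  ereal_inf [set beta%:E | beta in
    [set b : R | 0 <= b /\
      (0 < percolation b J [set w | infinite_set (open_cluster w 0)])%E]].

(* the kernel J-bar: J with 1 added at the nearest neighbours of the origin *)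
Definition add_nn (R : realType) (d : nat) (J : 'rV[int]_d -> R) (x : 'rV[int]_d) : R :=
  if enorm R x == 1 then J x + 1 else J x.

(* A Bernoulli sequence is read off a uniform point of [0, 1[ by successive
   subdivision of the interval. *)
Definition unif01 (R : realType) : set (measurableTypeR R) -> \bar R :=
  mrestr (@lebesgue_measure R) (@measurable_itv R `[0, 1[).
Section unif01.
Variable R : realType.
HB.instance Definition _ := Measure.on (@unif01 R).
Lemma unif01T : @unif01 R setT = 1%E.
Proof. by rewrite /unif01 /mrestr setTI lebesgue_measure_itv /= lte_fin ltr01 sube0. Qed.
HB.instance Definition _ := Measure_isProbability.Build _ _ _ (@unif01 R) unif01T.
End unif01.

Section bernoulli_sequence.
Variables (R : realType) (p : nat -> R).
Hypothesis p01 : forall n, 0 <= p n <= 1.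

(* [bernoulli_itv s] is the (left end, length) of the subinterval of [0, 1[
   on which the bits produced so far, latest first, are [s] *)
Fixpoint bernoulli_itv (s : seq bool) : R * R :=
  if s is b :: s' then
    let: (l, w) := bernoulli_itv s' in
    if b then (l, w * p (size s')) else (l + w * p (size s'), w * (1 - p (size s')))
  else (0, 1).

Fixpoint bernoulli_bits (u : R) (n : nat) : seq bool :=
  if n is n'.+1 then
    let s := bernoulli_bits u n' in
    (u < (bernoulli_itv s).1 + (bernoulli_itv s).2 * p n') :: s
  else [::].

Let bset s : set R :=
  [set u | (bernoulli_itv s).1 <= u < (bernoulli_itv s).1 + (bernoulli_itv s).2].

Let len_ge0 s : 0 <= (bernoulli_itv s).2.
Proof.
elim: s => //= b s; case: (bernoulli_itv s) => l w /= w0.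
by have := p01 (size s); case: b => /= /andP[? ?]; rewrite mulr_ge0// subr_ge0.
Qed.

Let bset_sub s : bset s `<=` `[0, 1[%classic.
Proof.
elim: s => [|b s IH] u; rewrite /bset /= in_itv /=; first by rewrite add0r.
move: IH; rewrite /bset; have := len_ge0 s; have := p01 (size s).
case: (bernoulli_itv s) => l w /= p_ w0 IH.
move=> H; have := IH u; rewrite /= in_itv /=; apply; move: H.
by case: b => /= /andP[? ?]; apply/andP; split; nra.
Qed.

Let bitsP s u : `[0, 1[%classic u ->
  bernoulli_bits u (size s) = s <-> bset s u.
Proof.
move=> u01; elim: s => [|b s IH].
  by split=> // _; move: u01; rewrite /bset /= in_itv /= add0r.
split.
  move=> /= [] + E; rewrite E; move/IH: E; rewrite /bset /=.
  have := len_ge0 s; have := p01 (size s).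
  case: (bernoulli_itv s) => l w /= p_ w0 /andP[lu uw].
  case: b => /= [-> |/negbT]; first by rewrite lu.
  rewrite -leNgt => ->/=; lra.
move=> H; have E : bernoulli_bits u (size s) = s.
  apply/IH; move: H; rewrite /bset /=.
  have := len_ge0 s; have := p01 (size s).
  case: (bernoulli_itv s) => l w /= p_ w0.
  by case: b => /= /andP[? ?]; apply/andP; split; nra.
rewrite /= E; congr cons; move: H; rewrite /bset /=.
case: (bernoulli_itv s) => l w /=.
by case: b => /= /andP[? ?] //; apply/negbTE; rewrite -leNgt.
Qed.

Let unif01_bset s : unif01 (bset s) = ((bernoulli_itv s).2)%:E.
Proof.
rewrite /unif01 /mrestr setIidl; last exact: bset_sub.
rewrite (_ : bset s = `[(bernoulli_itv s).1, (bernoulli_itv s).1 + (bernoulli_itv s).2[%classic); last first.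
  by apply/seteqP; split => u; rewrite /bset /= in_itv.
rewrite lebesgue_measure_itv/= lte_fin ltrDl.
have := len_ge0 s; rewrite le_eqVlt => /predU1P[<-|->]; first by rewrite ltxx.
by rewrite -EFinD addrAC subrr add0r.
Qed.

Let size_bits u n : size (bernoulli_bits u n) = n.
Proof. by elim: n => //= n ->. Qed.

Let measurable_bset s : measurable (bset s).
Proof.
rewrite (_ : bset s = `[(bernoulli_itv s).1, (bernoulli_itv s).1 + (bernoulli_itv s).2[%classic); last first.
  by apply/seteqP; split => u; rewrite /bset /= in_itv.
exact: measurable_itv.
Qed.

Let bits_event n (Q : seq bool -> bool) :
  [set u | Q (bernoulli_bits u n)] `&` `[0, 1[%classic =
  \bigcup_(t in [set t : n.-tuple bool | Q t]) bset t.
Proof.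
apply/seteqP; split=> u /=.
  move=> [Qu u01]; have E : size (bernoulli_bits u n) == n by rewrite size_bits.
  exists (Tuple E) => //=; apply/bitsP => //; by rewrite size_bits.
move=> [t Qt ut]; have u01 := bset_sub ut; split => //.
by move/(bitsP _ u01): ut; rewrite size_tuple => ->.
Qed.

Let bset_disj n : trivIset [set: n.-tuple bool] (fun t => bset t).
Proof.
move=> s t _ _ [u [us ut]]; have u01 := bset_sub us; apply/val_inj => /=.
by move/(bitsP _ u01): us => <-; move/(bitsP _ u01): ut => <-; rewrite !size_tuple.
Qed.

Let unif01_event n (Q : seq bool -> bool) :
  unif01 [set u | Q (bernoulli_bits u n)] =
  (\sum_(t : n.-tuple bool | Q t) (bernoulli_itv t).2)%:E.
Proof.
rewrite -sumEFin; under eq_bigr do rewrite -unif01_bset.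
transitivity (unif01 (\bigcup_(t in [set t : n.-tuple bool | Q t]) bset t)).
  by rewrite -bits_event /unif01/mrestr -setIA setIid.
rewrite measure_fin_bigcup; last 3 first.
- exact: finite_finset.
- by move=> s t _ _; exact: bset_disj.
- by move=> t _; exact: measurable_bset.
rewrite (_ : [set t : n.-tuple bool | Q t] =
    [set` seq.filter (fun t : n.-tuple bool => Q t) (enum {:n.-tuple bool})]); last first.
  apply/seteqP; split=> t /=; first by rewrite mem_filter mem_enum andbT.
  by rewrite mem_filter => /andP[].
rewrite -fsbig_seq; last by apply: filter_uniq; exact: enum_uniq.
rewrite big_filter big_enum_cond /=.
by apply: eq_bigl => t; rewrite ?andTb.
Qed.

Let unif01_step n (Q : seq bool -> bool) :
  unif01 [set u | head false (bernoulli_bits u n.+1) && Q (bernoulli_bits u n)] =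
  ((p n)%:E * unif01 [set u | Q (bernoulli_bits u n)])%E.
Proof.
rewrite (unif01_event n) -EFinM mulr_sumr.
rewrite (unif01_event n.+1 (fun s => head false s && Q (behead s))); congr EFin.
rewrite (reindex_onto (fun t : n.-tuple bool => [tuple of true :: t])
  (fun t : n.+1.-tuple bool => [tuple of behead t])) /=; last first.
  by move=> t /andP[ht _]; apply/val_inj => /=; case/tupleP: t ht => b t /= ->.
apply: eq_big => [t|t _].
  by rewrite (_ : (_ == t) = true) ?andbT//; apply/eqP/val_inj.
by rewrite size_tuple /=; case: (bernoulli_itv t) => l w /=; rewrite mulrC.
Qed.

Fixpoint all_bits (A : pred nat) (s : seq bool) : bool :=
  if s is b :: s' then (A (size s') ==> b) && all_bits A s' else true.

Lemma all_bitsP (A : pred nat) u n : reflect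
  (forall k, (k < n)%N -> A k -> head false (bernoulli_bits u k.+1) : bool)
  (all_bits A (bernoulli_bits u n)).
Proof.
elim: n => [|n IH]; first by constructor.
apply: (iffP andP); rewrite size_bits.
  move=> [/implyP An /IH Ak] k; rewrite ltnS leq_eqVlt => /predU1P[->//|]; exact: Ak.
move=> H; split; first by apply/implyP => /(H _ (ltnSn n)).
by apply/IH => k kn; apply: H; rewrite ltnS ltnW.
Qed.

Lemma unif01_all_bits (A : pred nat) n :
  unif01 [set u | all_bits A (bernoulli_bits u n)] = (\prod_(k < n | A k) p k)%:E.
Proof.
elim: n => [|n IH]; first by rewrite big_ord0 -unif01T; congr unif01; apply/seteqP.
rewrite big_mkcond big_ord_recr /= -big_mkcond /= EFinM -IH muleC.
under eq_set do rewrite size_bits.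
case: ifP => An.
  by rewrite -(unif01_step n (all_bits A)).
by rewrite mul1e.
Qed.

Lemma measurable_bit n :
  measurable ([set u | head false (bernoulli_bits u n)] `&` `[0, 1[%classic).
Proof.
rewrite (bits_event n (head false)); apply: fin_bigcup_measurable.
  exact: finite_finset.
by move=> t _; exact: measurable_bset.
Qed.

End bernoulli_sequence.

Lemma bernoulli_product_exists (R : realType) (I : countType) (p : I -> R) :
  (forall i, 0 <= p i <= 1) ->
  exists P : probability (config I) R, forall s : seq I, uniq s ->
    P [set w | all (w : I -> bool) s] = (\prod_(i <- s) p i)%:E.
Proof.
move=> p01; pose q n : R := oapp p 0 (@choice.pickle_inv I n).
have q01 n : 0 <= q n <= 1.
  by rewrite /q; case: pickle_inv => [i|] /=; [exact: p01|rewrite lexx ler01].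
pose X (u : R) (i : I) : bool :=
  (u \in `[0, 1[) && head false (bernoulli_bits q u (choice.pickle i).+1).
have mX : measurable_fun setT (X : measurableTypeR R -> config I).
  have e : @measurable _ (config I) = <<s @cylinders I >> by [].
  apply: (measurability _ e) => _ [_ [i ->]] <-.
  rewrite setTI.
  rewrite (_ : _ @^-1` _ = [set u | head false (bernoulli_bits q u (choice.pickle i).+1)] `&` `[0, 1[%classic).
    exact: measurable_bit.
  by apply/seteqP; split => u /=; rewrite /X; [move=> /andP[]|move=> [? ?]; apply/andP].
pose mf := isMeasurableFun.Build _ _ _ _ _ mX.
pose Y : {mfun measurableTypeR R >-> config I} := HB.pack (X : measurableTypeR R -> config I) mf.
exists (distribution (@unif01 R) Y) => s us.
pose N := \max_(i <- s) (choice.pickle i).+1.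
pose A k := k \in map choice.pickle s.
transitivity (unif01 [set u | all_bits A (bernoulli_bits q u N)]).
  rewrite /distribution /pushforward /unif01 /mrestr; congr lebesgue_measure.
  apply/seteqP; split=> u /= [H u01]; split => //.
    apply/all_bitsP => k kN /mapP[i si ->].
    by move/allP: H => /(_ i si) /andP[].
  move/all_bitsP : H => H; apply/allP => i si; apply/andP; split; first exact: u01.
  apply: H; last exact: map_f.
  by rewrite /N (big_rem i)//= leq_maxl.
rewrite unif01_all_bits//; congr EFin.
rewrite -(big_mkord A q) -big_filter (perm_big (map choice.pickle s)).
  by rewrite big_map; apply: eq_bigr => i _; rewrite /q choice.pickleK_inv.
apply: uniq_perm.
- by rewrite filter_uniq// iota_uniq.
- by rewrite map_inj_uniq//; exact: (pcan_inj choice.pickleK_inv).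
move=> k; rewrite mem_filter mem_index_iota /=.
have [/mapP[i si ->]|kA] := boolP (k \in map choice.pickle s); last by rewrite /A (negbTE kA).
by rewrite /A map_f//= /N (big_rem i)//= leq_maxl.
Qed.

Lemma edgeP (d : nat) (e : edge d) : exists x y, x != y /\ val e = [fset x; y]%fset.
Proof.
have : uniq (enum_fset (val e)) by exact: fset_uniq.
have : size (enum_fset (val e)) = 2%N by apply/eqP; exact: (valP e).
have : enum_fset (val e) =i val e by [].
case: (enum_fset (val e)) => [|x [|y [|]]]//= memE _; rewrite inE andbT => xy.
by exists x, y; split => //; apply/fsetP => z; rewrite -memE !inE.
Qed.

Lemma symmetric_kernelN (R : realType) (d : nat) (J : 'rV[int]_d -> R) :
  symmetric_kernel J -> forall x, J (- x) = J x.
Proof.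
move=> [_ Jf] x.
pose g (s : seq 'I_d) : 'rV[int]_d := \row_j (if j \in s then - x 0 j else x 0 j).
have H s : uniq s -> J (g s) = J x.
  elim: s => [_|i s IH /= /andP[si us]].
    by congr J; apply/rowP => j; rewrite mxE.
  rewrite -IH// -(Jf i); congr J; apply/rowP => j; rewrite !mxE inE.
  by case: eqVneq => [->|] //=; rewrite (negbTE si) opprK.
rewrite -(H (enum 'I_d)) ?enum_uniq//; congr J; apply/rowP => j.
by rewrite !mxE mem_enum.
Qed.

Lemma percolation_law_exists (R : realType) (d : nat) (beta : R) (J : 'rV[int]_d -> R) :
  0 <= beta -> (forall x, 0 <= J x) -> symmetric_kernel J ->
  exists P : probability (config (edge d)) R, percolation_law beta J P.
Proof.
move=> b0 J0 Jsym.
pose jump (e : edge d) := (enum_fset (val e))`_0 - (enum_fset (val e))`_1.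
pose p (e : edge d) : R := 1 - expR (- (beta * J (jump e))).
have p01 e : 0 <= p e <= 1.
  rewrite /p subr_ge0 lerBlDr lerDl expR_ge0 andbT -expR0 ler_expR oppr_le0.
  by rewrite mulr_ge0.
have [P HP] := bernoulli_product_exists p01; exists P => s sne su.
pose f (e : 'rV[int]_d * 'rV[int]_d) : option (edge d) := insub [fset e.1; e.2]%fset.
have fE e : e \in s -> exists e' : edge d, [/\ f e = Some e', val e' = [fset e.1; e.2]%fset &
    J (jump e') = J (e.1 - e.2)].
  move=> es; have ene := allP sne _ es.
  rewrite /f; case: insubP => [e' _ ve'|]; last by rewrite cardfs2 ene.
  exists e'; split => //; rewrite /jump.
  have : uniq (enum_fset (val e')) by exact: fset_uniq.
  have : size (enum_fset (val e')) = 2%N by apply/eqP; exact: (valP e').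
  have memE : enum_fset (val e') =i [fset e.1; e.2]%fset by move=> z; rewrite -ve'.
  case: (enum_fset (val e')) memE => [|u [|v [|]]]//= memE _; rewrite inE andbT => uv.
  have := memE u; have := memE v; rewrite !inE !eqxx /= orbT.
  move=> /esym/orP[/eqP vE|/eqP vE] /esym/orP[/eqP uE|/eqP uE].
  - by rewrite vE uE eqxx in uv.
  - by rewrite vE uE -(symmetric_kernelN Jsym) opprB.
  - by rewrite vE uE.
  - by rewrite vE uE eqxx in uv.
have [E1 E2 E3] : [/\ map val (pmap f s) = [seq [fset e.1; e.2]%fset | e <- s],
    forall w : config (edge d), all (w : edge d -> bool) (pmap f s) =
      all (fun e => is_open w e.1 e.2) s &
    \prod_(i <- pmap f s) p i =
      \prod_(e <- s) (1 - expR (- (beta * J (e.1 - e.2))))].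
  elim: s fE {sne su} => [|e s IH] fE; first by split; rewrite ?big_nil.
  have [|E1 E2 E3] := IH; first by move=> e' e's; apply: fE; rewrite inE e's orbT.
  have [|e' [fe ve' Je']] := fE e; first by rewrite mem_head.
  rewrite /= fe /=; split; first by rewrite ve' E1.
    by move=> w; rewrite E2 /is_open -/(f e) fe.
  by rewrite !big_cons E3 /p Je'.
rewrite -E3 -HP; last by rewrite -(map_inj_uniq val_inj) E1.
by congr (P _); apply/seteqP; split => w /=; rewrite E2.
Qed.

Lemma percolationP (R : realType) (d : nat) (beta : R) (J : 'rV[int]_d -> R) :
  0 <= beta -> (forall x, 0 <= J x) -> symmetric_kernel J ->
  percolation_law beta J (percolation beta J).
Proof.
move=> b0 J0 Js; have [P HP] := percolation_law_exists b0 J0 Js.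
exact: (xgetPex _ (ex_intro _ P HP)).
Qed.

Lemma measurable_edge_open (d : nat) (x y : 'rV[int]_d) :
  measurable [set w : config (edge d) | is_open w x y].
Proof.
rewrite /is_open; case: insubP => [e _ _|_] /=.
  by apply: sub_sigma_algebra; exists e.
rewrite (_ : [set _ | _] = set0); first exact: measurable0.
by apply/seteqP; split.
Qed.

Lemma measurable_all_open (d : nat) (s : seq ('rV[int]_d * 'rV[int]_d)) :
  measurable [set w : config (edge d) | all (fun e => is_open w e.1 e.2) s].
Proof.
elim: s => [|e s IH].
  rewrite (_ : [set _ | _] = setT); first exact: measurableT.
  by apply/seteqP; split.
rewrite (_ : [set _ | _] = [set w : config (edge d) | is_open w e.1 e.2] `&`
  [set w : config (edge d) | all (fun e => is_open w e.1 e.2) s]).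
  by apply: measurableI => //; exact: measurable_edge_open.
by apply/seteqP; split => w /=; [move=> /andP[]|move=> [? ?]; apply/andP].
Qed.

Lemma measurable_cluster (d : nat) (x y : 'rV[int]_d) :
  measurable [set w : config (edge d) | open_cluster w x y].
Proof.
rewrite (_ : [set _ | _] = \bigcup_(p in [set p | last x p = y])
    [set w : config (edge d) | path (is_open w) x p]); last first.
  by apply/seteqP; split => w /= [p ? ?]; exists p.
rewrite bigcup_mkcond; apply: countable_bigcupT_measurable; first exact: countableP.
move=> p; case: ifP => _; last exact: measurable0.
elim: p x => [|z p IH] x /=.
  rewrite (_ : [set _ | _] = setT); first exact: measurableT.
  by apply/seteqP; split.
rewrite (_ : [set _ | _] = [set w : config (edge d) | is_open w x z] `&`
  [set w : config (edge d) | path (is_open w) z p]).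
  by apply: measurableI => //; exact: measurable_edge_open.
by apply/seteqP; split => w /=; [move=> /andP[]|move=> [? ?]; apply/andP].
Qed.

Lemma measurable_infinite_cluster (d : nat) (x : 'rV[int]_d) :
  measurable [set w : config (edge d) | infinite_set (open_cluster w x)].
Proof.
rewrite (_ : [set _ | _] = \bigcap_n \bigcup_(B in [set B : {fset 'rV[int]_d} | (n <= #|` B|)%N])
    \bigcap_(y in [set` B]) [set w : config (edge d) | open_cluster w x y]); last first.
  apply/seteqP; split => w /=.
    by move=> /infinite_set_fsetP H n _; have [B BA nB] := H n; exists B.
  by move=> H; apply/infinite_set_fsetP => n; have [B nB BA] := H n I; exists B.
apply: bigcap_measurableType => n _.
rewrite bigcup_mkcond; apply: countable_bigcupT_measurable; first exact: countableP.
move=> B; case: ifP => _; last exact: measurable0.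
by apply: fin_bigcap_measurable => // y _; exact: measurable_cluster.
Qed.

Lemma percolation_law_unique (R : realType) (d : nat) (beta : R) (J : 'rV[int]_d -> R)
    (P Q : probability (config (edge d)) R) :
  percolation_law beta J P -> percolation_law beta J Q ->
  forall A, measurable A -> P A = Q A.
Proof.
move=> HP HQ.
pose K := [set A : set (config (edge d)) | exists s : seq (edge d),
   uniq s /\ A = [set w | all (w : edge d -> bool) s]].
have pairE (s : seq (edge d)) : exists t : seq ('rV[int]_d * 'rV[int]_d),
    [/\ all (fun e => e.1 != e.2) t, [seq [fset e.1; e.2]%fset | e <- t] = map val s &
     forall w : config (edge d), all (w : edge d -> bool) s = all (fun e => is_open w e.1 e.2) t].
  elim: s => [|e s [t [t1 t2 t3]]]; first by exists [::].
  have [x [y [xy exy]]] := edgeP e.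
  exists ((x, y) :: t); split; rewrite /= ?xy ?t2 ?exy//.
  move=> w; rewrite t3 /is_open; congr (_ && _).
  by rewrite -exy valK.
have PQ A : K A -> P A = Q A.
  move=> [s [su ->]]; have [t [t1 t2 t3]] := pairE s.
  rewrite (_ : [set _ | _] = [set w | all (fun e => is_open w e.1 e.2) t]); last first.
    by apply/seteqP; split => w /=; rewrite t3.
  by rewrite HP ?HQ// t2 map_inj_uniq//; exact: val_inj.
have KI : setI_closed K.
  move=> _ _ [s [su ->]] [t [tu ->]]; exists (undup (s ++ t)); split; first exact: undup_uniq.
  apply/seteqP; split => w /=.
    move=> [/allP ws /allP wt]; apply/allP => e; rewrite mem_undup mem_cat.
    by move=> /orP[/ws|/wt].
  move=> /allP H; split; apply/allP => e es; apply: H; by rewrite mem_undup mem_cat es ?orbT.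
move=> A mA.
have KE : @measurable _ (config (edge d)) = <<s K >>.
  apply/seteqP; split.
    apply: smallest_sub; first exact: smallest_sigma_algebra.
    move=> _ [e ->]; apply: sub_sigma_algebra; exists [:: e]; split => //.
    by apply/seteqP; split => w /=; rewrite andbT.
  apply: smallest_sub; first exact: sigma_algebra_measurable.
  move=> _ [s [_ ->]]; have [t [_ _ t3]] := pairE s.
  rewrite (_ : [set _ | _] = [set w : config (edge d) | all (fun e => is_open w e.1 e.2) t]).
    exact: measurable_all_open.
  by apply/seteqP; split => w /=; rewrite t3.
apply: (measure_unique K (fun=> setT)) => //.
- by move=> _; exists [::]; split => //; apply/seteqP; split.
- by rewrite bigcup_const.
- by move=> _; exact: (@fin_num_fun_lty).
Qed.

(* Main.v *)
Require Import Defs.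
From HB Require Import structures.
From mathcomp Require Import all_boot all_order all_algebra perm finmap.
From mathcomp Require Import ring lra zify.
From mathcomp Require Import all_classical all_reals all_analysis.
Set Implicit Arguments.
Unset Strict Implicit.
Unset Printing Implicit Defensive.
Import Order.TTheory GRing.Theory Num.Theory.
Import numFieldNormedType.Exports.
Local Open Scope classical_set_scope.
Local Open Scope ring_scope.

(** Fix a finite set [L] and let [T] be its complement.  For [o <-> T] to become
    true when an edge [{x, y}] opens, one needs [o <-> x], [y <-> T] and not
    [o <-> T].  Given any third vertex [z], either the edge [{x, z}] is pivotal
    as well, or isolating [x] (or [z]) and reconnecting it to [y] alone makes
    [{x, z}] pivotal; the costs for distinct [y] are paid by disjoint events, so
    the [J]-weighted number of pivotal edges at [x] is at most a constant times
    the probability that [{x, z}] is pivotal.  With [z = x + e_1] this handles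
    the [y] far from [x], where [J (x - y)] and [J (z - y)] are comparable; the
    near [y] are first moved far away with [z = x + 2 m e_1].  Russo's formula
    then shows that [P (o <-> T)] does not decrease, uniformly in [L], along
    [(beta - u) J + K u 1_{+-e_1}], so part of [beta J] can be traded for the
    extra steps.  This gives the strict inequality when [beta_c J] is finite and
    positive.  It is positive because, for small [beta], the expected number of
    open self-avoiding paths from [0] is finite.  If it is infinite then
    [d >= 2], and [add_nn J] percolates for large [beta] by a renormalization in
    boxes of side [3 ^ k] which are good when at most one of their nine subboxes
    is bad. *)

(** * Finite products of Bernoulli measures *)

(** The passage from [y] to [z] needs [J (x - y)] to be at most a constant times [J (z - y)]. Near
    the origin this can fail for [z = x + e_1], because nothing is known of [J] there, and [y] may
    be [z] itself. The jump [w0 = 2 m e_1] turns every near difference into a far one, where [J] is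
    positive. Joining an isolated vertex [a] to [y] alone costs [W (a - y) exp (- S)], where [S]
    bounds the total mass of the kernel; integrability makes this uniform in the volume. The infimum
    [beta_c J] need not be attained. The trade is therefore made at some [beta] slightly above it,
    by an amount [u] fixed beforehand, and the constant has to be uniform in [beta] over a window.
    In the renormalization, side three and one tolerated bad subbox fit together: a three by three
    grid stays connected without one cell, and adjacent boxes face each other along three pairs of
    cells, of which one bad cell on each side spoils at most two. *)

Section finite_expectation.
Context {R : realType} {E : eqType}.
Implicit Types (s : seq E) (w : E -> bool) (p q : E -> R) (g h : (E -> bool) -> R).

Definition setbit w (e : E) (b : bool) : E -> bool :=
  fun x => if x == e then b else w x.

(* The expectation of [g] when the coordinates in [s] are independent, [e] being
   true with probability [p e], and all other coordinates are false. *)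
Fixpoint expect p s g : R :=
  if s is e :: s' then
    p e * expect p s' (fun w => g (setbit w e true)) +
    (1 - p e) * expect p s' (fun w => g (setbit w e false))
  else g (fun=> false).

Definition supported s w := forall e, w e -> e \in s.

Lemma supported_cons e s w b : supported s w -> supported (e :: s) (setbit w e b).
Proof.
by move=> ws x; rewrite /setbit inE; case: eqP => //= _ /ws.
Qed.

Lemma setbitC w e f a b : e != f ->
  setbit (setbit w e a) f b = setbit (setbit w f b) e a.
Proof.
move=> ef; apply/funext => x; rewrite /setbit.
by case: (eqVneq x f) => [->|//]; rewrite eq_sym (negbTE ef).
Qed.

Lemma setbitK w e a b : setbit (setbit w e a) e b = setbit w e b.
Proof. by apply/funext => x; rewrite /setbit; case: eqP. Qed.

Lemma eq_expect p s g h : (forall w, supported s w -> g w = h w) ->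
  expect p s g = expect p s h.
Proof.
elim: s g h => [|e s IH] g h gh /=; first exact: gh.
by congr (_ * _ + _ * _); apply: IH => w ws; apply: gh; exact: supported_cons.
Qed.

Lemma le_expect p s g h : (forall e, 0 <= p e <= 1) ->
  (forall w, supported s w -> g w <= h w) -> expect p s g <= expect p s h.
Proof.
move=> p01; elim: s g h => [|e s IH] g h gh /=; first exact: gh.
have /andP[p0 p1] := p01 e.
apply: lerD; apply: ler_wpM2l; rewrite ?subr_ge0//.
  by apply: IH => w ws; apply: gh; exact: supported_cons.
by apply: IH => w ws; apply: gh; exact: supported_cons.
Qed.

Lemma expectD p s g h : expect p s (fun w => g w + h w) = expect p s g + expect p s h.
Proof. by elim: s g h => [//|e s IH] g h /=; rewrite !IH; ring. Qed.

Lemma expectZ p s (k : R) g : expect p s (fun w => k * g w) = k * expect p s g.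
Proof. by elim: s g => [//|e s IH] g /=; rewrite !IH; ring. Qed.

Lemma expect_cst p s (k : R) : expect p s (fun=> k) = k.
Proof. by elim: s => [//|e s IH] /=; rewrite !IH; ring. Qed.

Lemma expect_sum p s (I : Type) (r : seq I) (F : I -> (E -> bool) -> R) :
  expect p s (fun w => \sum_(i <- r) F i w) = \sum_(i <- r) expect p s (F i).
Proof.
elim: r => [|i r IH].
  by rewrite big_nil -[RHS](expect_cst p s); apply: eq_expect => w _; rewrite big_nil.
rewrite big_cons -IH -expectD; apply: eq_expect => w _.
by rewrite big_cons.
Qed.

Lemma expect_ge0 p s g : (forall e, 0 <= p e <= 1) ->
  (forall w, supported s w -> 0 <= g w) -> 0 <= expect p s g.
Proof. by move=> p01 g0; rewrite -(expect_cst p s 0); exact: le_expect. Qed.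

Lemma expect_indep p s (Q : pred E) g h :
  (forall w e b, Q e -> g (setbit w e b) = g w) ->
  (forall w e b, ~~ Q e -> h (setbit w e b) = h w) ->
  expect p s (fun w => g w * h w) = expect p s g * expect p s h.
Proof.
elim: s g h => [//|e s IH] g h gQ hQ /=.
have inv (k : (E -> bool) -> R) (S : pred E) c :
    (forall w e b, S e -> k (setbit w e b) = k w) ->
    forall w f b, S f -> k (setbit (setbit w f b) e c) = k (setbit w e c).
  move=> kS w f b Sf; case: (eqVneq f e) => [->|fe]; first by rewrite setbitK.
  by rewrite setbitC// kS.
rewrite !IH; try exact: (inv g Q); try exact: (inv h (fun e => ~~ Q e)).
case: (boolP (Q e)) => [Qe|Qe].
  by under [expect p s (fun w => g (setbit w e true))]eq_expect do rewrite gQ//;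
     under [expect p s (fun w => g (setbit w e false))]eq_expect do rewrite gQ//; ring.
by under [expect p s (fun w => h (setbit w e true))]eq_expect do rewrite hQ//;
   under [expect p s (fun w => h (setbit w e false))]eq_expect do rewrite hQ//; ring.
Qed.

Lemma expect_prod p s (F : E -> bool -> R) : uniq s ->
  expect p s (fun w => \prod_(e <- s) F e (w e)) =
  \prod_(e <- s) (p e * F e true + (1 - p e) * F e false).
Proof.
elim: s => [|e s IH] /=; first by rewrite !big_nil.
move=> /andP[es us]; rewrite big_cons -IH//.
have H b : expect p s (fun w => \prod_(e0 <- e :: s) F e0 (setbit w e b e0)) =
    F e b * expect p s (fun w => \prod_(e0 <- s) F e0 (w e0)).
  rewrite -expectZ; apply: eq_expect => w _.
  rewrite big_cons {1}/setbit eqxx; congr (_ * _).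
  rewrite big_seq [RHS]big_seq; apply: eq_bigr => x xs.
  by rewrite /setbit; case: eqP => // xe; rewrite -xe xs in es.
by rewrite !H; ring.
Qed.

Lemma expect_mono p q s g : (forall e, 0 <= p e <= 1) -> (forall e, 0 <= q e <= 1) ->
  (forall e, p e <= q e) ->
  (forall w w', (forall e, w e -> w' e) -> g w <= g w') ->
  expect p s g <= expect q s g.
Proof.
move=> p01 q01 pq; elim: s g => [//|e s IH] g gm /=.
have gm' b w w' : (forall x, w x -> w' x) -> g (setbit w e b) <= g (setbit w' e b).
  by move=> ww'; apply: gm => x; rewrite /setbit; case: eqP => // _ /ww'.
have A := IH _ (gm' true); have B := IH _ (gm' false).
have C : expect p s (fun w => g (setbit w e false)) <= expect p s (fun w => g (setbit w e true)).
  by apply: le_expect => // w _; apply: gm => x; rewrite /setbit; case: eqP.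
have := pq e; have := p01 e; have := q01 e; move=> /andP[q0 q1] /andP[p0 p1] pqe.
(* Raise the probability of [e] alone first: this moves mass to the larger branch. The other
   coordinates follow by induction within each branch. *)
apply: (@le_trans _ _ (q e * expect p s (fun w => g (setbit w e true)) +
   (1 - q e) * expect p s (fun w => g (setbit w e false)))); first by nra.
by apply: lerD; apply: ler_wpM2l; rewrite ?subr_ge0.
Qed.

(** Russo's formula. Since [1 - exp (- W)] has derivative [exp (- W)] in [W], which is the
    probability that the edge is closed, each term counts the closed edges whose opening changes
    [g], with no further factor. *)
Lemma is_derive_expect (W : E -> R -> R) (dW : E -> R) (u : R) s g : uniq s ->
  (forall e, is_derive u 1 (W e) (dW e)) ->
  is_derive u 1 (fun t => expect (fun e => 1 - expR (- W e t)) s g)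
    (\sum_(e <- s) dW e * expect (fun e => 1 - expR (- W e u)) s
       (fun w => (~~ w e)%:R * (g (setbit w e true) - g w))).
Proof.
move=> + dWE; elim: s g => [|e s IH] g /=.
  by move=> _; rewrite big_nil; exact: is_derive_cst.
move=> /andP[es us].
set p := fun e => 1 - expR (- W e u).
have dN : is_derive u 1 (- W e) (- dW e) by exact: is_deriveN.
have dX : is_derive u 1 (expR \o - W e) (expR (- W e u) * - dW e).
  exact: is_derive1_comp.
have dp : is_derive u 1 (fun t => 1 - expR (- W e t)) (dW e * expR (- W e u)).
  have -> : dW e * expR (- W e u) = 0 - expR (- W e u) * - dW e.
    by rewrite sub0r mulrN opprK mulrC.
  exact: (@is_deriveB _ _ _ (cst (1 : R)) _ u 1 0 _ (is_derive_cst _ _ _) dX).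
have dq : is_derive u 1 (fun t => 1 - (1 - expR (- W e t))) (- (dW e * expR (- W e u))).
  rewrite -[X in is_derive _ _ _ X]sub0r.
  exact: (@is_deriveB _ _ _ (cst (1 : R)) _ u 1 0 _ (is_derive_cst _ _ _) dp).
have IH1 := IH (fun w => g (setbit w e true)) us.
have IH0 := IH (fun w => g (setbit w e false)) us.
rewrite -/p in IH1 IH0.
have := is_deriveD (is_deriveM dp IH1) (is_deriveM dq IH0).
set df := (X in is_derive _ _ _ X) => D.
suff -> : \sum_(f <- e :: s) dW f * expect p (e :: s)
    (fun w => (~~ w f)%:R * (g (setbit w f true) - g w)) = df by exact: D.
rewrite /df {D df}.
rewrite big_cons /=.
set X1 := expect p s (fun w => g (setbit w e true)).
set X0 := expect p s (fun w => g (setbit w e false)).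
(* At the head coordinate only the branch with [e] closed contributes; its weight [1 - p e] is the
   derivative of [p e] with respect to [W e]. *)
rewrite (_ : expect p s (fun w => (~~ setbit w e true e)%:R * _) = 0); last first.
  rewrite -[RHS](expect_cst p s); apply: eq_expect => w _.
  by rewrite /setbit eqxx mul0r.
rewrite (_ : expect p s (fun w => (~~ setbit w e false e)%:R * _) = X1 - X0); last first.
  rewrite /X1 /X0 -[in RHS]mulN1r -expectZ -expectD; apply: eq_expect => w _.
  by rewrite setbitK {1}/setbit eqxx mul1r mulN1r.
set S := \sum_(_ <- _) _; set S1 := \sum_(_ <- _) _; set S0 := \sum_(_ <- _) _.
have -> : S = p e * S1 + (1 - p e) * S0.
  rewrite /S /S1 /S0 !mulr_sumr -big_split /= big_seq [RHS]big_seq.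
  apply: eq_bigr => f fs; have fe : f != e by apply: contra es => /eqP <-.
  have X b : expect p s (fun w => (~~ setbit w e b f)%:R *
        (g (setbit (setbit w e b) f true) - g (setbit w e b))) =
      expect p s (fun w => (~~ w f)%:R *
        (g (setbit (setbit w f true) e b) - g (setbit w e b))).
    apply: eq_expect => w _.
    by rewrite {1}/setbit (negbTE fe) setbitC// eq_sym.
  by rewrite !X; ring.
rewrite /GRing.scale /= -/(p e); have -> : expR (- W e u) = 1 - p e by rewrite /p; ring.
ring.
Qed.

End finite_expectation.

Definition ind {R : realType} (A : Prop) : R := (`[< A >])%:R.

Lemma ind_ge0 {R : realType} (A : Prop) : 0 <= ind A :> R.
Proof. exact: ler0n. Qed.

Lemma le_ind {R : realType} (A B : Prop) : (A -> B) -> ind A <= ind B :> R.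
Proof. by move=> AB; rewrite /ind ler_nat; case: asboolP => // /AB/asboolT ->. Qed.

Lemma indT {R : realType} (A : Prop) : A -> ind A = 1 :> R.
Proof. by move=> /asboolT; rewrite /ind => ->. Qed.

Lemma indF {R : realType} (A : Prop) : ~ A -> ind A = 0 :> R.
Proof. by move=> /asboolF; rewrite /ind => ->. Qed.

(** * Finite marginals of the infinite product measure *)

Section finite_marginals.
Context {R : realType} {I : eqType}.
Variables (P : probability (config I) R) (p : I -> R).
Implicit Types (s t : seq I) (G : (I -> bool) -> Prop).

Definition bernoulli_law := forall s, uniq s ->
  P [set w : config I | all (w : I -> bool) s] = (\prod_(i <- s) p i)%:E.

Hypothesis PB : bernoulli_law.

(** Coordinates off [s] are set to false, the convention of [expect]. *)
Definition restrict s (w : I -> bool) : I -> bool := fun i => (i \in s) && w i.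

Lemma restrict_cons i s w : i \notin s ->
  restrict (i :: s) w = setbit (restrict s w) i (w i).
Proof.
move=> iNs; apply/funext => j; rewrite /restrict /setbit inE.
by case: eqP => //= ->.
Qed.

Lemma measurable_coordinate i : measurable [set w : config I | w i].
Proof. by apply: sub_sigma_algebra; exists i. Qed.

Lemma measurable_coordinates s : measurable [set w : config I | all (w : I -> bool) s].
Proof.
elim: s => [|i s IH].
  by rewrite (_ : [set _ | _] = setT); [exact: measurableT|apply/seteqP; split].
rewrite (_ : [set _ | _] = [set w : config I | w i] `&` [set w : config I | all (w : I -> bool) s]).
  by apply: measurableI => //; exact: measurable_coordinate.
by apply/seteqP; split => w /=; [move=> /andP[]|move=> [? ?]; apply/andP].
Qed.

Let restrict_split i s G : i \notin s ->
  [set w : config I | G (restrict (i :: s) w)] =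
  ([set w : config I | w i] `&` [set w : config I | G (setbit (restrict s w) i true)]) `|`
  ([set w : config I | G (setbit (restrict s w) i false)] `\` [set w : config I | w i]).
Proof.
move=> iNs; apply/seteqP; split=> w /=; rewrite restrict_cons//.
  case wi: (w i) => /= Gw; first by left.
  by right; split => //; rewrite wi.
by case: (w i) => /= [[[] //|[]//]|[[]//|[]//]].
Qed.

Lemma measurable_restrict s G : uniq s -> measurable [set w : config I | G (restrict s w)].
Proof.
elim: s G => [|i s IH] G /=.
  move=> _; have [G0|G0] := pselect (G (fun=> false)).
    by rewrite (_ : [set _ | _] = setT); [exact: measurableT|apply/seteqP; split].
  by rewrite (_ : [set _ | _] = set0); [exact: measurable0|apply/seteqP; split].
move=> /andP[iNs us]; rewrite restrict_split//; apply: measurableU.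
  by apply: measurableI; [exact: measurable_coordinate|exact: (IH (fun w => G (setbit w i true)))].
by apply: measurableD; [exact: (IH (fun w => G (setbit w i false)))|exact: measurable_coordinate].
Qed.

(** The law is known only on events saying that coordinates are open. In the induction, open
    coordinates move from [s] to [t], and closed ones are handled by subtracting the open case. *)
Let probability_restrict_all t s G : uniq (t ++ s) ->
  P ([set w : config I | all (w : I -> bool) t] `&` [set w : config I | G (restrict s w)]) =
  ((\prod_(i <- t) p i) * expect p s (fun w => ind (G w)))%:E.
Proof.
elim: s t G => [|i s IH] t G.
  rewrite cats0 => ut /=; have [G0|G0] := pselect (G (fun=> false)).
    by rewrite indT// mulr1 -PB//; congr (P _); apply/seteqP; split => w //= [].
  rewrite indF// mulr0 (_ : _ `&` _ = set0) ?measure0//.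
  by apply/seteqP; split => w //= [].
move=> uts; have iNs : i \notin s by move: uts; rewrite cat_uniq /= => /and4P[].
have us : uniq s by move: uts; rewrite cat_uniq /= => /and4P[].
have uits : uniq ((i :: t) ++ s) by have := uts; rewrite -(cat1s i s) uniq_catCA.
have uts' : uniq (t ++ s) by move: uits => /=/andP[].
set T := [set w : config I | all (w : I -> bool) t].
pose G1 := [set w : config I | G (setbit (restrict s w) i true)].
pose G0 := [set w : config I | G (setbit (restrict s w) i false)].
pose T' := [set w : config I | all (w : I -> bool) (i :: t)].
have mG1 : measurable G1 by exact: (measurable_restrict (fun w => G (setbit w i true))).
have mG0 : measurable G0 by exact: (measurable_restrict (fun w => G (setbit w i false))).
have mT : measurable T by exact: measurable_coordinates.
have mT' : measurable T' by exact: measurable_coordinates.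
have -> : T `&` [set w : config I | G (restrict (i :: s) w)] =
   (T' `&` G1) `|` ((T `&` G0) `\` (T' `&` G0)).
  rewrite restrict_split//; apply/seteqP; split => w /=; rewrite /T' /G1 /G0 /T /=.
    move=> [wt [[wi g]|[g wi]]]; first by left; rewrite wi.
    by right; split => //; case=> /andP[].
  move=> [[/andP[wi wt] g]|[[wt g] n]]; first by split=> //; left.
  split => //; right; split => // wi; apply: n; split => //.
  by rewrite wi.
rewrite measureU//; last 3 first.
- exact: measurableI.
- by apply: measurableD; exact: measurableI.
- apply/seteqP; split => w //= [[T'w _] [[_ g0] n]]; exact: n.
rewrite measureD//; last 3 first.
- exact: measurableI.
- exact: measurableI.
- by apply: (le_lt_trans (probability_le1 _ _)); [exact: measurableI|rewrite ltry].
rewrite (_ : T `&` G0 `&` (T' `&` G0) = T' `&` G0); last first.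
  apply/seteqP; split => w /=; rewrite /T' /T /= => -[] //.
  by move=> /andP[wi wt] g; rewrite wi wt.
have E0 : P (T `&` G0) = _ := IH t (fun w => G (setbit w i false)) uts'.
have E0' : P (T' `&` G0) = _ := IH (i :: t) (fun w => G (setbit w i false)) uits.
have E1 : P (T' `&` G1) = _ := IH (i :: t) (fun w => G (setbit w i true)) uits.
transitivity (P (T' `&` G1) + (P (T `&` G0) - P (T' `&` G0)))%E => //.
rewrite E0 E0' E1.
by rewrite -EFinB -EFinD big_cons /=; congr EFin; ring.
Qed.

Lemma probability_restrict s G : uniq s ->
  P [set w : config I | G (restrict s w)] = (expect p s (fun w => ind (G w)))%:E.
Proof.
move=> us; have := @probability_restrict_all [::] s G us.
rewrite big_nil mul1r => <-; congr (P _).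
by apply/seteqP; split => w //= [].
Qed.

End finite_marginals.

(** * Open paths *)

Section edges.
Context {d : nat}.
Local Notation V := 'rV[int]_d.
Implicit Types (w : config (edge d)) (e : edge d) (x y z : V).

Definition src e : V := (enum_fset (val e))`_0.
Definition tgt e : V := (enum_fset (val e))`_1.

Lemma edge_endsP e : src e != tgt e /\ val e = [fset src e; tgt e]%fset.
Proof.
have : uniq (enum_fset (val e)) by exact: fset_uniq.
have : size (enum_fset (val e)) = 2%N by apply/eqP; exact: (valP e).
have : enum_fset (val e) =i val e by [].
rewrite /src /tgt.
case: (enum_fset (val e)) => [|x [|y [|]]]//= memE _; rewrite inE andbT => xy.
by split => //; apply/fsetP => z; rewrite -memE !inE.
Qed.

Lemma fset2_inj x y z t : [fset x; y]%fset = [fset z; t]%fset :> {fset V} ->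
  (x = z /\ y = t) \/ (x = t /\ y = z).
Proof.
move=> E.
have : x \in [fset z; t]%fset by rewrite -E !inE eqxx.
have : y \in [fset z; t]%fset by rewrite -E !inE eqxx orbT.
have : z \in [fset x; y]%fset by rewrite E !inE eqxx.
have : t \in [fset x; y]%fset by rewrite E !inE eqxx orbT.
rewrite !inE => /orP[]/eqP ? /orP[]/eqP ? /orP[]/eqP ? /orP[]/eqP ?;
by subst; auto.
Qed.

Lemma edge_at x y : x != y -> {e : edge d | val e = [fset x; y]%fset}.
Proof.
move=> xy; have c : #|` [fset x; y]%fset| == 2%N by rewrite cardfs2 xy.
by exists (exist (fun e : {fset V} => #|` e| == 2%N) _ c).
Qed.

Lemma is_openE w e x y : val e = [fset x; y]%fset -> is_open w x y = (w : edge d -> bool) e.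
Proof. by move=> exy; rewrite /is_open -exy valK. Qed.

Lemma is_openP w x y : is_open w x y ->
  exists e, [/\ val e = [fset x; y]%fset, (w : edge d -> bool) e & x != y].
Proof.
rewrite /is_open; case: insubP => //= e c E we; exists e; split => //.
by move: c; rewrite cardfs2; case: (x != y).
Qed.

Lemma is_openC w x y : is_open w x y = is_open w y x.
Proof. by rewrite /is_open fsetUC. Qed.

Lemma is_open_le w w' x y : (forall e, (w : edge d -> bool) e -> (w' : edge d -> bool) e) ->
  is_open w x y -> is_open w' x y.
Proof. by move=> ww' /is_openP[e [E /ww' we _]]; rewrite (is_openE _ E). Qed.

Definition edge_weight {R : realType} (W : V -> R) e : R := W (src e - tgt e).

Lemma edge_weightE {R : realType} (W : V -> R) e x y : (forall v, W (- v) = W v) ->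
  val e = [fset x; y]%fset -> edge_weight W e = W (x - y).
Proof.
move=> WN; have [_ ->] := edge_endsP e.
by move=> /fset2_inj[[<- <-]|[<- <-]]//; rewrite -WN opprB.
Qed.

Lemma bernoulli_percolation {R : realType} (beta : R) (J : V -> R)
    (P : probability (config (edge d)) R) : percolation_law beta J P ->
  bernoulli_law P (fun e => 1 - expR (- (beta * edge_weight J e))).
Proof.
move=> PJ s us; pose t := [seq (src e, tgt e) | e <- s].
have tE : [seq [fset f.1; f.2]%fset | f <- t] = map val s.
  by rewrite -map_comp; apply: eq_map => e /=; have [_ <-] := edge_endsP e.
rewrite (_ : [set _ | _] = [set w | all (fun f => is_open w f.1 f.2) t]); last first.
  apply/seteqP; split => w /=; rewrite all_map => H; apply/allP => e es;
  by have := allP H _ es; rewrite /= (is_openE _ (proj2 (edge_endsP e))).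
rewrite PJ ?big_map//.
  by rewrite all_map; apply/allP => e _ /=; have [] := edge_endsP e.
by rewrite tE map_inj_uniq//; exact: val_inj.
Qed.

End edges.

(** * Clusters, isolation of a vertex, pivotality *)

Section connectivity.
Context {d : nat}.
Local Notation V := 'rV[int]_d.
Implicit Types (w : config (edge d)) (e : edge d) (x y z : V).

Lemma cluster_refl w x : open_cluster w x x.
Proof. by exists [::]. Qed.

Lemma cluster_trans w x y z : open_cluster w x y -> open_cluster w y z -> open_cluster w x z.
Proof.
move=> [p wp <-] [q wq <-]; exists (p ++ q); last by rewrite last_cat.
by rewrite cat_path wp.
Qed.

Lemma cluster_step w x y : is_open w x y -> open_cluster w x y.
Proof. by move=> xy; exists [:: y] => //=; rewrite xy. Qed.

Lemma cluster_ind w (S : V -> Prop) x y : open_cluster w x y -> S x ->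
  (forall u v, S u -> is_open w u v -> S v) -> S y.
Proof.
move=> [p + <-] + H; elim: p x => [//|u p IH] x /= /andP[xu wp] Sx.
by apply: IH => //; exact: H xu.
Qed.

Lemma cluster_sym w x y : open_cluster w x y -> open_cluster w y x.
Proof.
move=> xy; apply: (cluster_ind (S := fun v => open_cluster w v x) xy).
  exact: cluster_refl.
by move=> u v ux uv; apply: cluster_trans ux; apply: cluster_step; rewrite is_openC.
Qed.

Lemma cluster_le w w' x y : (forall e, (w : edge d -> bool) e -> (w' : edge d -> bool) e) ->
  open_cluster w x y -> open_cluster w' x y.
Proof.
move=> ww' [p wp <-]; exists p => //; move: wp; apply: sub_path => u v.
exact: is_open_le.
Qed.

Definition isolate a w : config (edge d) :=
  fun e => (w : edge d -> bool) e && (a \notin val e).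

Lemma is_open_isolate a w x y :
  is_open (isolate a w) x y = [&& is_open w x y, a != x & a != y].
Proof.
rewrite /is_open; case: insubP => [e c E|//]; rewrite [LHS]/= [in RHS]/=.
by rewrite /isolate E !inE negb_or.
Qed.

Lemma isolate_le a w e : (isolate a w : edge d -> bool) e -> (w : edge d -> bool) e.
Proof. by move=> /andP[]. Qed.

Lemma isolated_cluster a w x : open_cluster (isolate a w) a x -> x = a.
Proof.
move=> [[|y p] /= + <-] //; by rewrite is_open_isolate eqxx andbF.
Qed.

Lemma cluster_avoid w a x y : open_cluster w x y -> ~ open_cluster w x a ->
  open_cluster (isolate a w) x y.
Proof.
move=> xy xa.
suff [] : open_cluster w x y /\ open_cluster (isolate a w) x y by [].
apply: (cluster_ind (S := fun v => open_cluster w x v /\ open_cluster (isolate a w) x v) xy).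
  by split; exact: cluster_refl.
move=> u v [xu axu] uv; have xv : open_cluster w x v by exact: (cluster_trans xu (cluster_step uv)).
split => //; apply: (cluster_trans axu); apply: cluster_step; rewrite is_open_isolate uv /=.
by apply/andP; split; apply/eqP => E; subst; contradiction.
Qed.

(* The first of [a] and [b] met by a path from [o] ending in [b]. *)
Lemma cluster_first w o a b : a != b -> open_cluster w o b ->
  open_cluster (isolate a w) o b \/ open_cluster (isolate b w) o a.
Proof.
move=> ab [p]; elim: p o => [|y p IH] o /=.
  by move=> _ ->; left; exact: cluster_refl.
move=> /andP[oy yp] pb.
have [->|oa] := eqVneq o a; first by right; exact: cluster_refl.
have [->|ob] := eqVneq o b; first by left; exact: cluster_refl.
have [E|ya] := eqVneq y a.
  right; apply: cluster_step; rewrite is_open_isolate -{1}E oy.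
  by rewrite eq_sym ob eq_sym ab.
have [E|yb] := eqVneq y b.
  left; apply: cluster_step; rewrite is_open_isolate -{1}E oy.
  by rewrite eq_sym oa ab.
have [H|H] := IH _ yp pb; [left|right]; apply: cluster_trans H; apply: cluster_step.
  by rewrite is_open_isolate oy eq_sym oa eq_sym ya.
by rewrite is_open_isolate oy eq_sym ob eq_sym yb.
Qed.

Variables (o : V) (T : set V).

Definition reaches w x := exists2 t, T t & open_cluster w x t.

Lemma reaches_le w w' x : (forall e, (w : edge d -> bool) e -> (w' : edge d -> bool) e) ->
  reaches w x -> reaches w' x.
Proof. by move=> ww' [t Tt xt]; exists t => //; exact: cluster_le xt. Qed.

Lemma reaches_trans w x y : open_cluster w x y -> reaches w y -> reaches w x.
Proof. by move=> xy [t Tt yt]; exists t => //; exact: cluster_trans yt. Qed.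

Lemma reaches_avoid w a x : reaches w x -> ~ open_cluster w x a -> reaches (isolate a w) x.
Proof. by move=> [t Tt xt] xa; exists t => //; exact: cluster_avoid. Qed.

(* The edge between [x] and [y] is closed, and opening it connects [o] to [T]
   through [x] first. *)
Definition piv x y w := [/\ open_cluster w o x, reaches w y & ~ reaches w o].

(** Demanded of all [e], this makes [a] a pendant vertex hanging on [y]. It constrains the edges at
    [a] alone, exactly those that [isolate a] ignores. *)
Definition only a y w (e : edge d) : bool :=
  (a \in val e) ==> ((w : edge d -> bool) e == (val e == [fset a; y]%fset)).

(** If [z] reaches [T], then [z] can replace [y]. Otherwise the connection from [y] to [T] avoids
    [z], and it avoids [x] because [o] does not reach [T]; the path from [o] to [x] meets [x] before
    [z] or [z] before [x], which separates the last two cases. *)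
Lemma piv_shift x y z w : x != z -> piv x y w ->
  [\/ piv x z w, piv z y (isolate x w) | piv x y (isolate z w)].
Proof.
move=> xz [ox yT oT].
have [zT|zT] := pselect (reaches w z); first by constructor 1.
have oT' a : ~ reaches (isolate a w) o.
  by move=> aoT; apply: oT; apply: reaches_le aoT; exact: isolate_le.
have [H|H] : open_cluster (isolate z w) o x \/ open_cluster (isolate x w) o z.
  by apply: cluster_first => //; rewrite eq_sym.
- constructor 3; split => //; apply: reaches_avoid => // yz.
  by apply: zT; apply: reaches_trans yT; exact: cluster_sym.
- constructor 2; split => //; apply: reaches_avoid => // yx.
  by apply: oT; apply: (reaches_trans ox); apply: reaches_trans yT; exact: cluster_sym.
Qed.

(** The vertex [a] now reaches [T] through [y]. Its only open edge leads to [y], which [o] does not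
    reach, so no new connection from [o] arises. *)
Lemma piv_attach a b y w : a != b -> a != y -> piv b y (isolate a w) ->
  (forall e, only a y w e) -> piv b a w.
Proof.
move=> ab ay [ob yT oT] H.
have oa : o != a.
  by apply/eqP => E; move: ob; rewrite E => /isolated_cluster /esym/eqP; apply/negP.
have openE u : is_open w a u -> u = y.
  move=> /is_openP[e [E we au]]; have := H e; rewrite /only E !inE eqxx /= we => /eqP/esym/eqP.
  by move=> /fset2_inj[[_ //]|[E1 _]]; rewrite E1 eqxx in ay.
have noy : ~ open_cluster (isolate a w) o y.
  by move=> oy; apply: oT; exact: reaches_trans yT.
have lift v : open_cluster w o v -> open_cluster (isolate a w) o v.
  move=> ov; apply: (cluster_ind (S := fun v => open_cluster (isolate a w) o v) ov).
    exact: cluster_refl.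
  move=> u v' ou uv.
  have ua : a != u.
    by apply/eqP => E; move/cluster_sym: ou; rewrite -E => /isolated_cluster oa'; rewrite oa' eqxx in oa.
  apply: (cluster_trans ou); apply: cluster_step; rewrite is_open_isolate uv ua /=.
  by apply/eqP => E; apply: noy; rewrite -(openE u)// is_openC E.
split.
- by apply: cluster_le ob; exact: isolate_le.
- have yT' : reaches w y by apply: reaches_le yT; exact: isolate_le.
  apply: reaches_trans yT'.
  apply: cluster_step; have [e E] := edge_at ay; rewrite (is_openE _ E).
  by have := H e; rewrite /only E !inE !eqxx => /eqP.
- by move=> [t Tt ot]; apply: oT; exists t => //; exact: lift.
Qed.

End connectivity.

(** * Pivotal edges *)

Section sums.
Context {R : realType}.

Lemma sum_le_inj (I L : eqType) (r : seq I) (t : seq L) (f : I -> L)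
    (F : I -> R) (G : L -> R) : uniq r -> uniq t -> {in r &, injective f} ->
  (forall i, i \in r -> f i \in t) -> (forall i, i \in r -> F i <= G (f i)) ->
  (forall l, 0 <= G l) -> \sum_(i <- r) F i <= \sum_(l <- t) G l.
Proof.
move=> ur ut fi ft FG G0.
apply: (@le_trans _ _ (\sum_(i <- r) G (f i))).
  by rewrite big_seq [leRHS]big_seq; exact: ler_sum.
rewrite -(big_map f xpredT G).
rewrite (bigID [in map f r]) /= [leRHS](bigID [in map f r]) /=.
rewrite -[X in X + _ <= _]big_filter -[X in _ <= X + _]big_filter.
rewrite (@perm_big _ _ _ _ [seq i <- map f r | i \in map f r] [seq i <- t | i \in map f r]).
  rewrite lerD2l [X in X <= _]big1_seq; first by apply: sumr_ge0.
  by move=> i /andP[/negP].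
apply: uniq_perm; rewrite ?filter_uniq ?map_inj_in_uniq// => i; rewrite !mem_filter.
by case: (boolP (i \in map f r)) => //= /mapP[j jr ->]; rewrite ft.
Qed.

Lemma sum_ind_le (I : eqType) (r : seq I) (A : I -> Prop) (B : Prop) : uniq r ->
  {in r &, forall i j, A i -> A j -> i = j} -> {in r, forall i, A i -> B} ->
  \sum_(i <- r) ind (A i) <= ind B :> R.
Proof.
elim: r => [|i r IH]; first by rewrite big_nil ind_ge0.
move=> /= /andP[ir ur] AA AB; rewrite big_cons.
have [Ai|Ai] := pselect (A i); last first.
  rewrite (indF Ai) add0r; apply: IH => //.
    by move=> j k jr kr; apply: AA; rewrite inE ?jr ?kr orbT.
  by move=> j jr; apply: AB; rewrite inE jr orbT.
rewrite (indT (AB i (mem_head _ _) Ai)) (indT Ai) big1_seq ?addr0// => j /= jr.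
rewrite indF// => Aj; move: ir; rewrite (AA i j) ?jr ?mem_head// inE jr orbT //.
Qed.

End sums.

Section edges_in.
Context {d : nat}.
Local Notation V := 'rV[int]_d.
Implicit Types (B : {fset V}) (e : edge d).

Definition edges_in B : seq (edge d) :=
  undup (pmap insub [seq [fset x; y]%fset | x <- B, y <- B]).

Lemma edges_in_uniq B : uniq (edges_in B). Proof. exact: undup_uniq. Qed.

Lemma mem_edges_in B e : (e \in edges_in B) = (src e \in B) && (tgt e \in B).
Proof.
have [st E] := edge_endsP e.
rewrite mem_undup mem_pmap_sub; apply/allpairsP/andP => /= [[[x y] /= [xB yB]]|[sB tB]].
  by rewrite E => /fset2_inj[[-> ->]|[-> ->]].
by exists (src e, tgt e).
Qed.

Lemma mem_edges_inE B e x y : val e = [fset x; y]%fset ->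
  (e \in edges_in B) = (x \in B) && (y \in B).
Proof.
rewrite mem_edges_in; have [_ ->] := edge_endsP e.
by move=> /fset2_inj[[-> ->]|[-> ->]]//; rewrite andbC.
Qed.

Definition other_end (a : V) e : V := if src e == a then tgt e else src e.

Lemma other_endP a e : a \in val e -> val e = [fset a; other_end a e]%fset /\ a != other_end a e.
Proof.
have [st E] := edge_endsP e; rewrite /other_end {1}E !inE.
case: (eqVneq (src e) a) => [<- _|sa]; first by rewrite -E.
by move=> /= /eqP ->; rewrite fsetUC -E eq_sym.
Qed.

End edges_in.

(** * Pivotal edges at a single vertex *)

Section pivotal_estimates.
Context {R : realType} {d : nat}.
Local Notation V := 'rV[int]_d.
Variables (o : V) (T : set V) (B : {fset V}) (W : V -> R) (S : R).
Hypothesis W_ge0 : forall x, 0 <= W x.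
Hypothesis WN : forall x : V, W (- x) = W x.
Hypothesis W_sum : forall r : seq V, uniq r -> \sum_(x <- r) W x <= S.

Local Notation p := (fun e => 1 - expR (- edge_weight W e)).
Local Notation Pr A := (expect p (edges_in B) (fun w => ind (A w))).

Lemma open_probability_itv (e : edge d) : 0 <= p e <= 1.
Proof.
rewrite subr_ge0 lerBlDr lerDl expR_ge0 andbT -expR0 ler_expR oppr_le0.
exact: W_ge0.
Qed.
Local Notation p01 := open_probability_itv.

Lemma degree_sum a : \sum_(e <- edges_in B | a \in val e) edge_weight W e <= S.
Proof.
rewrite -big_filter.
set r := [seq e <- _ | _].
apply: (@le_trans _ _ (\sum_(v <- [seq a - other_end a e | e <- r]) W v)).
  rewrite big_map big_seq [leRHS]big_seq; apply: ler_sum => e.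
  rewrite mem_filter => /andP[/other_endP[E _] _].
  by rewrite (edge_weightE WN E).
apply: W_sum; rewrite map_inj_in_uniq ?filter_uniq ?edges_in_uniq// => e f.
rewrite !mem_filter => /andP[/other_endP[E _] _] /andP[/other_endP[F _] _].
move=> /addrI/oppr_inj H; apply: val_inj; by rewrite E F H.
Qed.

(** The probability is [1 - exp (- W)] for the edge to [y] times [exp (- W)] for each other edge at
    [a]. Since [1 - exp (- t) >= t * exp (- t)], this is at least [W (a - y)] times the product of
    [exp (- W)] over all edges at [a]. *)
Lemma only_probability a y : a != y -> a \in B -> y \in B ->
  W (a - y) * expR (- S) <= Pr (fun w => forall e, only a y w e).
Proof.
move=> ay aB yB; have [e0 E0] := edge_at ay.
have e0s : e0 \in edges_in B by rewrite (mem_edges_inE _ E0) aB.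
have W0 : edge_weight W e0 = W (a - y) by exact: edge_weightE.
pose F (e : edge d) (b : bool) : R := if a \in val e then (b == (e == e0))%:R else 1.
apply: (@le_trans _ _ (expect p (edges_in B) (fun w => \prod_(e <- edges_in B) F e (w e)))); last first.
  apply: le_expect; first exact: p01.
  move=> w ws; have [H|H] := pselect (forall e, only a y w e).
    rewrite indT//; apply: prodr_ile1 => e _.
    by rewrite /F; case: ifP => _; rewrite ?ler0n ?ler01 ?lexx// lern1 leq_b1.
  rewrite indF//.
  (* A violation occurs inside [edges_in B]: outside, [w] is false, and the one edge that has to be
     open, [e0], lies in the list. *)
  have [e /negP He] : exists e, ~ only a y w e by exact/existsNP.
  move: He; rewrite /only negb_imply => /andP[ae we].
  have es : e \in edges_in B.
    apply: contraT => es; move: we; rewrite (_ : w e = false); last first.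
      by apply/negP => /ws; apply/negP.
    rewrite eq_sym eqbF_neg negbK => /eqP Ee.
    by rewrite -(val_inj (etrans E0 (esym Ee))) e0s in es.
  rewrite (big_rem e)//= {1}/F ae.
  rewrite (_ : (w e == (e == e0)) = false) ?mul0r//.
  by apply/negbTE; move: we; rewrite -E0 val_eqE.
rewrite expect_prod ?edges_in_uniq//.
apply: (@le_trans _ _ (\prod_(e <- edges_in B) ((if e == e0 then W (a - y) else 1) *
    expR (- (if a \in val e then edge_weight W e else 0))))); last first.
  apply: ler_prod => e _; apply/andP; split.
    by apply: mulr_ge0; rewrite ?expR_ge0//; case: ifP.
  rewrite /F; case: (boolP (a \in val e)) => ae; last first.
    rewrite (_ : e == e0 = false); first by rewrite oppr0 expR0; lra.
    by apply/negP => /eqP E; move: ae; rewrite E E0 !inE eqxx.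
  have [->|ee] := eqVneq e e0.
    rewrite /= W0 mulr1 mulr0 addr0.
    have := expR_ge1Dx (W (a - y)); have := expR_gt0 (- W (a - y)).
    have := expRxMexpNx_1 (W (a - y)); set u := expR _; set v := expR _; nra.
  by rewrite /= mul1r mulr0 mulr1 add0r; lra.
rewrite big_split /=.
rewrite (_ : \prod_(e <- _) expR _ =
    expR (- \sum_(e <- edges_in B | a \in val e) edge_weight W e)); last first.
  by rewrite -expR_sum sumrN [in RHS]big_mkcond.
rewrite (bigD1_seq e0) ?edges_in_uniq//= eqxx.
rewrite (eq_bigr (fun=> 1)) => [|e /negbTE -> //]; rewrite big1// mulr1.
by rewrite ler_wpM2l// ler_expR lerN2 degree_sum.
Qed.

(** The pivotal event ignores the edges at [a], while [only a y] sees nothing else, so the two are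
    independent. Together they make the edge from [b] to [a] pivotal by [piv_attach], and for
    distinct [y] the events [only a y] are disjoint, so the sum over [y] is paid for once. *)
Lemma sum_piv_isolate (c : R) a b (Y : seq V) (j : V -> R) : uniq Y -> a != b ->
  a \in B -> 0 <= c ->
  {in Y, forall y, [/\ y \in B, a != y, 0 <= j y & j y <= c * W (a - y)]} ->
  \sum_(y <- Y) j y * Pr (fun w => piv o T b y (isolate a w)) <=
  c * expR S * Pr (piv o T b a).
Proof.
move=> uY ab aB c0 HY.
pose A y w := piv o T b y (isolate a w) /\ forall e, only a y w e.
apply: (@le_trans _ _ (\sum_(y <- Y) c * expR S * Pr (A y))).
  rewrite big_seq [leRHS]big_seq; apply: ler_sum => y /HY[yB ay j0 jW].
  have -> : Pr (A y) = Pr (fun w => piv o T b y (isolate a w)) * Pr (fun w => forall e, only a y w e).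
    rewrite -(@expect_indep _ _ _ _ (fun e : edge d => a \in val e)).
    - apply: eq_expect => w _; rewrite /ind -natrM mulnb.
      by congr (nat_of_bool _)%:R; rewrite -asbool_and.
    - move=> w e b' ae; congr (ind (piv o T b y _)); apply/funext => f.
      by rewrite /isolate /setbit; case: (eqVneq f e) => // ->; rewrite ae !andbF.
    - move=> w e b' ae; congr ind; apply/propext; split => H f; have := H f;
      by rewrite /only /setbit; case: (eqVneq f e) => // ->; rewrite (negbTE ae).
  have := only_probability ay aB yB.
  set x1 := Pr (fun w => forall e, _); set x2 := expect _ _ _ => H.
  have x20 : 0 <= x2 by apply: expect_ge0 => [|w _]; [exact: p01|exact: ind_ge0].
  have H' : W (a - y) <= expR S * x1.
    by rewrite -ler_pdivrMl ?expR_gt0// -expRN mulrC.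
  rewrite -mulrA [x2 * x1]mulrC [expR S * _]mulrA [c * (_ * _)]mulrA ler_wpM2r//.
  by apply: (le_trans jW); rewrite ler_wpM2l.
rewrite -mulr_sumr ler_wpM2l ?mulr_ge0 ?expR_ge0// -expect_sum.
apply: le_expect; first exact: p01.
move=> w _; apply: sum_ind_le => //.
- move=> y z yY zY [_ Hy] [_ Hz].
  have [_ ay _ _] := HY _ yY; have [e E] := edge_at ay.
  have := Hy e; have := Hz e; rewrite /only !E !inE !eqxx /= => /eqP -> /eqP/eqP.
  by move=> /fset2_inj[[_ //]|[_ E2]]; rewrite E2 eqxx in ay.
- by move=> y yY [Hp Ho]; have [_ ay _ _] := HY _ yY; exact: piv_attach Hp Ho.
Qed.

(** The three cases of [piv_shift]: the first contributes the total weight of [j], the other two are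
    [sum_piv_isolate] at [x] and at [z], which is why [j] is compared with [W] seen from both
    vertices. *)
Lemma sum_piv (c : R) x z (Y : seq V) (j : V -> R) : uniq Y -> x != z ->
  x \in B -> z \in B -> 0 <= c ->
  {in Y, forall y, [/\ y \in B, x != y, z != y & 0 <= j y]} ->
  {in Y, forall y, j y <= c * W (x - y) /\ j y <= c * W (z - y)} ->
  \sum_(y <- Y) j y * Pr (piv o T x y) <=
  (\sum_(y <- Y) j y + c * expR S) * (Pr (piv o T x z) + Pr (piv o T z x)).
Proof.
move=> uY xz xB zB c0 HY HW.
have Pr0 A : 0 <= Pr A by apply: expect_ge0 => [|w _]; [exact: p01|exact: ind_ge0].
apply: (@le_trans _ _ (\sum_(y <- Y) (j y * Pr (piv o T x z) +
   (j y * Pr (fun w => piv o T z y (isolate x w)) +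
    j y * Pr (fun w => piv o T x y (isolate z w)))))).
  rewrite big_seq [leRHS]big_seq; apply: ler_sum => y /HY[yB xy zy j0].
  rewrite -!mulrDr ler_wpM2l// -!expectD; apply: le_expect; first exact: p01.
  move=> w _; have [H|H] := pselect (piv o T x y w); last first.
    by rewrite (indF H) !addr_ge0 ?ind_ge0.
  rewrite (indT H); have [G|G|G] := piv_shift xz H; rewrite (indT G).
  - by rewrite lerDl addr_ge0 ?ind_ge0.
  - by rewrite addrCA lerDl addr_ge0 ?ind_ge0.
  - by rewrite addrA lerDr addr_ge0 ?ind_ge0.
rewrite !big_split /= -mulr_suml.
have zx : z != x by rewrite eq_sym.
have H1 := @sum_piv_isolate c x z Y j uY xz xB c0.
have H2 := @sum_piv_isolate c z x Y j uY zx zB c0.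
have {}H1 := H1 (fun y yY => let: And4 a b _ e := HY y yY in And4 a b e (proj1 (HW y yY))).
have {}H2 := H2 (fun y yY => let: And4 a _ b e := HY y yY in And4 a b e (proj2 (HW y yY))).
apply: (@le_trans _ _ ((\sum_(y <- Y) j y) * Pr (piv o T x z) +
  (c * expR S * Pr (piv o T z x) + c * expR S * Pr (piv o T x z)))).
  by rewrite lerD2l lerD.
have J0 : 0 <= \sum_(y <- Y) j y.
  by rewrite big_seq; apply: sumr_ge0 => y /HY[].
rewrite !mulrDl !mulrDr.
have := mulr_ge0 J0 (Pr0 (piv o T z x)).
set a1 := _ * _; set a2 := _ * _; set a3 := _ * _; set a4 := _ * _; lra.
Qed.

End pivotal_estimates.

(** The factor of [sum_piv] when [SJ] bounds the sum of the weights and [c = A * k]. *)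
Definition shift_const {R : realType} (SJ S k A : R) : R := SJ + A * k * expR S.

(** At one vertex the far edges cost [K0]; the near ones cost [K0] to reach the jump by [w0] and
    [K0 / kappa] to pass from the jump to steps. The factor 8 is 2 for the orientations of an edge,
    2 for those of a step, and 2 for the steps at [x] and at [x + w0]. *)
Definition comparison_const {R : realType} (SJ S k A kappa : R) : R :=
  let K0 := shift_const SJ S k A in 8 * (K0 + K0 * (K0 / kappa)).

Lemma int_row_mulr2n_eq0 (d : nat) (v : 'rV[int]_d) : v *+ 2 = 0 -> v = 0.
Proof.
move=> H; apply/rowP => i; have /eqP := congr1 (fun v : 'rV[int]_d => v 0 i) H.
by rewrite mulr2n !mxE -mulr2n mulrn_eq0 => /eqP.
Qed.

(** * All pivotal edges against pivotal steps *)

Section pivotal_comparison.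
Context {R : realType} {d : nat}.
Local Notation V := 'rV[int]_d.
Variables (o : V) (L : {fset V}) (B : {fset V}) (J W : V -> R) (SJ S k A kappa : R).
Variables (e1 w0 : V) (far : pred V).
Hypothesis J_ge0 : forall x, 0 <= J x.
Hypothesis JN : forall x : V, J (- x) = J x.
Hypothesis J_sum : forall r : seq V, uniq r -> \sum_(x <- r) J x <= SJ.
Hypothesis W_ge0 : forall x, 0 <= W x.
Hypothesis WN : forall x : V, W (- x) = W x.
Hypothesis W_sum : forall r : seq V, uniq r -> \sum_(x <- r) W x <= S.
Hypothesis k_ge0 : 0 <= k.
Hypothesis JW : forall x, J x <= k * W x.
Hypothesis A_ge1 : 1 <= A.
Hypothesis J_far : forall x, far x -> J x <= A * J (x + e1).
Hypothesis J_near : forall x, ~~ far x -> J x <= A * J (x + w0).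
Hypothesis farN : forall x : V, far (- x) = far x.
Hypothesis far0 : ~~ far 0.
Hypothesis far1 : ~~ far e1.
Hypothesis far_w0 : far w0.
Hypothesis e1_neq0 : e1 != 0.
Hypothesis kappa_gt0 : 0 < kappa.
Hypothesis J_w0 : kappa <= J w0.

Local Notation p := (fun e => 1 - expR (- edge_weight W e)).
Local Notation T := (~` [set` L]).
Local Notation Pr A := (expect p (edges_in B) (fun w => ind (A w))).

Let far_neq x y : far x -> ~~ far y -> x != y.
Proof. by move=> fx fy; apply/eqP => E; rewrite E (negbTE fy) in fx. Qed.

Let p01 := open_probability_itv W_ge0.

Let Pr_ge0 D : 0 <= Pr D.
Proof. by apply: expect_ge0 => [|w _]; [exact: p01|exact: ind_ge0]. Qed.

Let K0 : R := shift_const SJ S k A.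

Let SJ_ge0 : 0 <= SJ.
Proof. by have := @J_sum [::] isT; rewrite big_nil. Qed.

Let Ak_ge0 : 0 <= A * k.
Proof. by apply: mulr_ge0 => //; apply: le_trans A_ge1. Qed.

Let K0_ge0 : 0 <= K0.
Proof. by apply: addr_ge0 => //; apply: mulr_ge0 => //; exact: expR_ge0. Qed.

Let sum_piv_J x z (Y : seq V) : uniq Y -> x != z -> x \in B -> z \in B ->
  {in Y, forall y, [/\ y \in B, x != y & z != y]} ->
  {in Y, forall y, J (x - y) <= A * J (z - y)} ->
  \sum_(y <- Y) J (x - y) * Pr (piv o T x y) <=
  K0 * (Pr (piv o T x z) + Pr (piv o T z x)).
Proof.
move=> uY xz xB zB HY HJ.
apply: (@le_trans _ _ ((\sum_(y <- Y) J (x - y) + A * k * expR S) *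
    (Pr (piv o T x z) + Pr (piv o T z x)))).
  apply: (sum_piv o T W_ge0 WN W_sum) => //.
    by move=> y yY; have [? ? ?] := HY y yY.
  move=> y yY; split.
    apply: (le_trans (JW _)); rewrite -mulrA ler_peMl//.
    exact: mulr_ge0.
  apply: (le_trans (HJ y yY)); rewrite -mulrA ler_wpM2l ?JW//.
  exact: le_trans A_ge1.
rewrite ler_wpM2r ?addr_ge0// lerD2r -(big_map (fun y => x - y) xpredT J).
by apply: J_sum; rewrite map_inj_uniq// => y y' /addrI/oppr_inj.
Qed.

Let Q x := Pr (piv o T x (x + e1)) + Pr (piv o T (x + e1) x).

Let Q_ge0 x : 0 <= Q x. Proof. exact: addr_ge0. Qed.

Let K1 : R := K0 + K0 * (K0 / kappa).

Let vertex_bound x : x \in B -> x + e1 \in B -> x + w0 \in B -> x + w0 + e1 \in B ->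
  \sum_(y <- B | y != x) J (x - y) * Pr (piv o T x y) <= K1 * (Q x + Q (x + w0)).
Proof.
move=> xB xeB xwB xweB.
have xe (v : V) : v != v + e1 by rewrite -subr_eq0 opprD addNKr oppr_eq0.
have w00 : w0 != 0 by exact: far_neq.
have xw : x != x + w0 by rewrite -subr_eq0 opprD addNKr oppr_eq0.
have w0e : w0 != e1 by exact: far_neq.
have w0Ne : w0 != - e1 by apply: far_neq; rewrite ?farN.
(* The jump edge is itself far, so from either end it is compared with a step; [kappa <= J w0] then
   allows division. *)
have H1 : J w0 * Pr (piv o T x (x + w0)) <= K0 * Q x.
  have := @sum_piv_J x (x + e1) [:: x + w0] isT (xe x) xB xeB.
  rewrite big_seq1 opprD addNKr JN; apply.
    move=> y; rewrite inE => /eqP ->; split => //.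
    by rewrite -subr_eq0 opprD addrACA subrr add0r subr_eq0 eq_sym.
  move=> y; rewrite inE => /eqP ->.
  have -> : x + e1 - (x + w0) = x - (x + w0) + e1 by rewrite addrAC.
  by apply: J_far; rewrite opprD addNKr farN.
have H2 : J w0 * Pr (piv o T (x + w0) x) <= K0 * Q (x + w0).
  have := @sum_piv_J (x + w0) (x + w0 + e1) [:: x] isT (xe _) xwB xweB.
  have E : x + w0 - x = w0 by rewrite addrAC subrr add0r.
  rewrite big_seq1 E; apply.
    move=> y; rewrite inE => /eqP ->; split => //; first by rewrite eq_sym.
    by rewrite -subr_eq0 addrAC E addr_eq0.
  move=> y; rewrite inE => /eqP ->.
  by rewrite [x + w0 + e1 - x]addrAC E; exact: J_far.
have H3 : Pr (piv o T x (x + w0)) + Pr (piv o T (x + w0) x) <=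
    K0 / kappa * (Q x + Q (x + w0)).
  rewrite mulrAC ler_pdivlMr// mulrC mulrDr mulrDr.
  apply: lerD; [apply: le_trans H1|apply: le_trans H2]; exact: ler_wpM2r.
rewrite (bigID (fun y => far (x - y))) /=.
have H4 : \sum_(y <- B | (y != x) && far (x - y)) J (x - y) * Pr (piv o T x y) <= K0 * Q x.
  rewrite -big_filter; apply: sum_piv_J => //; first by rewrite filter_uniq ?fset_uniq.
    move=> y; rewrite mem_filter => /andP[/andP[yx fy] yB]; split => //.
      by rewrite eq_sym.
    rewrite -subr_eq0 addrAC addr_eq0; apply: far_neq => //.
    by rewrite farN.
  move=> y; rewrite mem_filter => /andP[/andP[yx fy] yB].
  by rewrite [x + e1 - y]addrAC; exact: J_far.
(* Near [y] are compared with the jump edge first; [H3] leads from there to steps. *)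
have H5 : \sum_(y <- B | (y != x) && ~~ far (x - y)) J (x - y) * Pr (piv o T x y) <=
    K0 * (Pr (piv o T x (x + w0)) + Pr (piv o T (x + w0) x)).
  rewrite -big_filter; apply: sum_piv_J => //; first by rewrite filter_uniq ?fset_uniq.
    move=> y; rewrite mem_filter => /andP[/andP[yx fy] yB]; split => //.
      by rewrite eq_sym.
    rewrite -subr_eq0 addrAC addr_eq0 -eqr_oppLR eq_sym; apply: far_neq => //.
    by rewrite farN.
  move=> y; rewrite mem_filter => /andP[/andP[yx fy] yB].
  by rewrite [x + w0 - y]addrAC; exact: J_near.
apply: (le_trans (lerD H4 H5)).
have -> : K1 * (Q x + Q (x + w0)) = K0 * (Q x + Q (x + w0)) + K0 * (K0 / kappa * (Q x + Q (x + w0))).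
  by rewrite /K1; ring.
by apply: lerD; apply: ler_wpM2l => //; rewrite lerDl.
Qed.

(** The unoriented form of [piv], which is what Russo's formula produces; it forces [e] to be
    closed. *)
Definition edge_piv (e : edge d) (w : edge d -> bool) :=
  ~ reaches T w o /\ reaches T (setbit w e true) o.

(** Opening [e] is of no effect unless [o] is already joined to an endpoint. From that endpoint, any
    new connection to [T] crosses [e], so the other endpoint reaches [T] without it. *)
Lemma edge_piv_piv e w : edge_piv e w ->
  piv o T (src e) (tgt e) w \/ piv o T (tgt e) (src e) w.
Proof.
move=> [oT oT'].
have [st E] := edge_endsP e.
have open_cases (u v : V) : is_open (setbit w e true : config (edge d)) u v ->
    is_open w u v \/ (u = src e /\ v = tgt e) \/ (u = tgt e /\ v = src e).
  move=> /is_openP[f [F + uv]]; rewrite /setbit; case: (eqVneq f e) => [fe _|_ wf].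
    by right; move: F; rewrite fe E => /fset2_inj[[-> ->]|[-> ->]]; auto.
  by left; rewrite (is_openE _ F).
have half (a b : V) : (forall u v, is_open (setbit w e true : config (edge d)) u v ->
    is_open w u v \/ (u = a /\ v = b) \/ (u = b /\ v = a)) ->
    open_cluster w o a -> reaches T w b.
  move=> cases oa; have [t Tt ot] := oT'.
  have [ot'|bt] : open_cluster w o t \/ open_cluster w b t.
  - apply: (cluster_ind (S := fun v => open_cluster w o v \/ open_cluster w b v) ot).
      by left; exact: cluster_refl.
    move=> u v ouv /cases[uv|[[_ ->]|[_ ->]]]; [|by right; exact: cluster_refl|by left].
    by case: ouv => uu; [left|right]; apply: (cluster_trans uu); exact: cluster_step.
  - by exfalso; apply: oT; exists t.
  - by exists t.
have [os|os] := pselect (open_cluster w o (src e)).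
  by left; split => //; apply: half os.
have [ot|ot] := pselect (open_cluster w o (tgt e)).
  right; split => //; apply: half ot => u v /open_cases; tauto.
exfalso; have [t Tt ott] := oT'; apply: oT; exists t => //.
apply: (cluster_ind (S := fun v => open_cluster w o v) ott); first exact: cluster_refl.
move=> u v ou /open_cases[uv|[[us _]|[ut _]]].
- by apply: (cluster_trans ou); exact: cluster_step.
- by exfalso; apply: os; rewrite -us.
- by exfalso; apply: ot; rewrite -ut.
Qed.

Lemma piv_edge_piv x y e w : val e = [fset x; y]%fset -> piv o T x y w -> edge_piv e w.
Proof.
move=> E [ox yT oT]; split => //.
have le f : w f -> setbit w e true f by rewrite /setbit; case: eqP.
apply: (@reaches_trans _ _ _ o y); last exact: reaches_le yT.
apply: (cluster_trans (cluster_le le ox)); apply: cluster_step.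
by rewrite (is_openE _ E) /setbit eqxx.
Qed.

Definition step_weight (v : V) : R := ((v == e1) || (v == - e1))%:R.

(** Shifts are made only at vertices [x] joined to [o] while [o] does not reach [T]; these lie in
    [L]. *)
Definition margin_closed := forall x, x \in L ->
  [/\ x \in B, x + e1 \in B, x + w0 \in B & x + w0 + e1 \in B].

Lemma pivotal_comparison : margin_closed ->
  \sum_(e <- edges_in B) edge_weight J e * Pr (edge_piv e) <=
  comparison_const SJ S k A kappa *
    \sum_(e <- edges_in B) edge_weight step_weight e * Pr (edge_piv e).
Proof.
move=> HB.
pose phi (xy : V * V) := if xy.2 == xy.1 then 0 else J (xy.1 - xy.2) * Pr (piv o T xy.1 xy.2).
have phi0 xy : 0 <= phi xy by rewrite /phi; case: ifP => // _; exact: mulr_ge0.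
pose BB := [seq (x, y) | x <- B, y <- B].
have uBB : uniq BB by apply: allpairs_uniq; rewrite ?fset_uniq// => -[? ?] [].
have K1_ge0 : 0 <= K1 by rewrite /K1 addr_ge0// mulr_ge0// divr_ge0// ltW.
set RH := \sum_(e <- _) edge_weight step_weight e * _.
have stepN v : step_weight (- v) = step_weight v.
  by rewrite /step_weight eqr_opp orbC eqr_oppLR.
have half x : x \in B -> x + e1 \in B -> exists e, [/\ e \in edges_in B,
    val e = [fset x; (x + e1)%R]%fset & edge_weight step_weight e = 1].
  move=> xB xeB; have xe : x != x + e1 by rewrite -subr_eq0 opprD addNKr oppr_eq0.
  have [e E] := edge_at xe; exists e; split => //; first by rewrite (mem_edges_inE _ E) xB.
  by rewrite (edge_weightE stepN E) opprD addNKr stepN /step_weight eqxx.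
have Qsum (f : V -> V) : injective f -> (forall x, x \in L -> f x \in B /\ f x + e1 \in B) ->
    \sum_(x <- L) Q (f x) <= 2 * RH.
  move=> fi fL.
  (* Off [L] any edge serves; only the values on [L] are used. *)
  have g x : {e : edge d | x \in L -> [/\ e \in edges_in B,
    val e = [fset f x; (f x + e1)%R]%fset & edge_weight step_weight e = 1]}.
    apply: cid; case: (boolP (x \in L)) => xL.
      have [fB feB] := fL x xL; have [e He] := half _ fB feB.
      by exists e.
    have xe : f x != f x + e1 by rewrite -subr_eq0 opprD addNKr oppr_eq0.
    by have [e _] := edge_at xe; exists e.
  rewrite /RH mulr_sumr.
  apply: (@sum_le_inj _ _ _ _ _ (fun x => sval (g x))).
  - exact: fset_uniq.
  - exact: edges_in_uniq.
  - move=> x y xL yL; case: (g x) => e /= /(_ xL)[_ E _]; case: (g y) => e' /= /(_ yL)[_ E' _].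
    (* Two base points with the same step edge differ only by a swap of its ends, which would give
       [e1 *+ 2 = 0]. *)
    move=> ee; move: E'; rewrite -ee E => /fset2_inj[[/fi //]|[X Y]].
    have := Y; rewrite X -addrA -[RHS]addr0 -mulr2n => /addrI X2.
    by move: e1_neq0; rewrite (int_row_mulr2n_eq0 X2) eqxx.
  - by move=> x xL; case: (g x) => e /= /(_ xL)[].
  - move=> x xL; case: (g x) => e /= /(_ xL)[eB E s1].
    rewrite s1 mul1r mulr2n mulrDl mul1r; apply: lerD; apply: le_expect; try exact: p01.
      by move=> w _; apply: le_ind; exact: piv_edge_piv.
    by move=> w _; apply: le_ind; apply: piv_edge_piv; rewrite fsetUC.
  - by move=> e; rewrite mulr_ge0// mulr_ge0// ler0n.
have step1 (f : edge d -> V * V) : (forall e, f e = (src e, tgt e)) \/ (forall e, f e = (tgt e, src e)) ->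
    \sum_(e <- edges_in B) phi (f e) <= \sum_(xy <- BB) phi xy.
  move=> Hf; apply: sum_le_inj => //; first exact: edges_in_uniq.
    move=> e e' _ _ ff; apply: val_inj.
    have [_ ->] := edge_endsP e; have [_ ->] := edge_endsP e'.
    by case: Hf => H; move: ff; rewrite !H => -[-> ->].
  move=> e; rewrite mem_edges_in => /andP[sB tB].
  by case: Hf => ->; apply/allpairsP; [exists (src e, tgt e)|exists (tgt e, src e)].
have step2 : \sum_(e <- edges_in B) edge_weight J e * Pr (edge_piv e) <=
    2 * \sum_(xy <- BB) phi xy.
  apply: (@le_trans _ _ (\sum_(e <- edges_in B) (phi (src e, tgt e) + phi (tgt e, src e)))).
    rewrite big_seq [leRHS]big_seq; apply: ler_sum => e _.
    have [st _] := edge_endsP e.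
    rewrite /phi /= eq_sym (negbTE st) -(JN (tgt e - src e)) opprB.
    rewrite -mulrDr ler_wpM2l//; first exact: J_ge0.
    rewrite -expectD; apply: le_expect; first exact: p01.
    move=> w _; have [H|H] := pselect (edge_piv e w); last by rewrite (indF H) addr_ge0 ?ind_ge0.
    by rewrite (indT H); have [G|G] := edge_piv_piv H; rewrite (indT G) ?lerDl ?lerDr ind_ge0.
  rewrite big_split /= mulr2n mulrDl mul1r; apply: lerD; apply: step1; by [left|right].
apply: (le_trans step2).
have -> : comparison_const SJ S k A kappa = 8 * K1 by [].
suff : \sum_(xy <- BB) phi xy <= 4 * K1 * RH by lra.
rewrite /BB big_allpairs_dep /=.
apply: (@le_trans _ _ (\sum_(x <- L) K1 * (Q x + Q (x + w0)))); last first.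
  rewrite -mulr_sumr big_split /= mulrAC [4 * RH]mulrC.
  have H1 := @Qsum id (fun _ _ => id) (fun x xL => let: And4 a b _ _ := HB x xL in conj a b).
  have H2 := @Qsum (fun x => x + w0) (@addIr _ w0) (fun x xL => let: And4 _ _ a b := HB x xL in conj a b).
  rewrite [RH * 4 * K1]mulrC ler_wpM2l//; move: H1 H2; rewrite /=; lra.
(* A first endpoint outside [L] lies in [T], so [o] joined to it contradicts the failure to reach
   [T]. *)
rewrite (bigID [in L]) /= [X in _ + X]big1 ?addr0; last first.
  move=> x xL; apply: big1 => y _; rewrite /phi /=; case: ifP => // _.
  rewrite (_ : Pr _ = 0) ?mulr0//; rewrite -[RHS](expect_cst p (edges_in B) 0).
  by apply: eq_expect => w _; rewrite indF// => -[ox _ oT]; apply: oT; exists x => //=; exact/negP.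
rewrite -big_filter; set LB := [seq x <- B | x \in L].
apply: (@sum_le_inj _ _ _ _ _ id) => //.
- by rewrite filter_uniq ?fset_uniq.
- exact: fset_uniq.
- by move=> x; rewrite mem_filter => /andP[].
- move=> x; rewrite mem_filter => /andP[xL xB].
  have [x1 x2 x3 x4] := HB x xL.
  apply: le_trans (vertex_bound x1 x2 x3 x4).
  rewrite [leRHS]big_mkcond /=; apply: ler_sum => y _.
  by rewrite /phi /=; case: eqVneq.
- by move=> x; rewrite mulr_ge0// addr_ge0.
Qed.

End pivotal_comparison.

(** * Trading long edges for steps *)

Section finite_comparison.
Context {R : realType} {d : nat}.
Local Notation V := 'rV[int]_d.
Variables (o : V) (L B : {fset V}) (J : V -> R) (SJ A kappa b M : R).
Variables (e1 w0 : V) (far : pred V).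
Hypothesis J_ge0 : forall x, 0 <= J x.
Hypothesis JN : forall x : V, J (- x) = J x.
Hypothesis J_sum : forall r : seq V, uniq r -> \sum_(x <- r) J x <= SJ.
Hypothesis A_ge1 : 1 <= A.
Hypothesis J_far : forall x, far x -> J x <= A * J (x + e1).
Hypothesis J_near : forall x, ~~ far x -> J x <= A * J (x + w0).
Hypothesis farN : forall x : V, far (- x) = far x.
Hypothesis far0 : ~~ far 0.
Hypothesis far1 : ~~ far e1.
Hypothesis far_w0 : far w0.
Hypothesis e1_neq0 : e1 != 0.
Hypothesis kappa_gt0 : 0 < kappa.
Hypothesis J_w0 : kappa <= J w0.
Hypothesis b_gt0 : 0 < b.

(** While [trade_const * t <= b], the kernel traded by [t] has mass at most [M * SJ + 2 * b]; while
    [beta - t >= b], it dominates [b * J]. Bounding the step part by [b] keeps the constant from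
    depending on itself. *)
Definition trade_const : R := comparison_const SJ (M * SJ + 2 * b) b^-1 A kappa.

Definition traded_kernel (beta u : R) (x : V) : R :=
  (beta - u) * J x + trade_const * u * step_weight e1 x.

Local Notation p beta u := (fun e => 1 - expR (- edge_weight (traded_kernel beta u) e)).
Local Notation T := (~` [set` L]).

Lemma step_weightN x : step_weight e1 (- x) = step_weight e1 x :> R.
Proof. by rewrite /step_weight eqr_opp orbC eqr_oppLR. Qed.

Lemma step_weight_ge0 x : 0 <= step_weight e1 x :> R.
Proof. exact: ler0n. Qed.

Lemma step_weight_sum (r : seq V) : uniq r -> \sum_(x <- r) step_weight e1 x <= 2 :> R.
Proof.
move=> ur; apply: (@le_trans _ _ (\sum_(x <- undup [:: e1; - e1]) 1)).
  rewrite (bigID [in [:: e1; - e1]]) /= [X in _ + X]big1 ?addr0.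
    rewrite -big_filter; apply: (@sum_le_inj _ _ _ _ _ id) => //.
    - by rewrite filter_uniq.
    - exact: (undup_uniq [:: e1; - e1]).
    - by move=> x; rewrite mem_filter -(mem_undup [:: e1; - e1]) => /andP[].
    - by move=> x _; rewrite /step_weight lern1 leq_b1.
  by move=> x; rewrite !inE /step_weight => /negbTE ->.
by rewrite big_const_seq iter_addr_0 ler_nat count_predT size_undup.
Qed.

Lemma kernel_sum_ge0 : 0 <= SJ.
Proof. by have := @J_sum [::] isT; rewrite big_nil. Qed.

Lemma trade_const_ge0 : 0 <= trade_const.
Proof.
have SJ_ge0 := kernel_sum_ge0.
rewrite /trade_const /comparison_const.
have : 0 <= shift_const SJ (M * SJ + 2 * b) b^-1 A.
  by rewrite /shift_const addr_ge0// !mulr_ge0// ?expR_ge0 ?invr_ge0 ?ltW// (lt_le_trans _ A_ge1).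
set K0 := shift_const _ _ _ _ => K00.
by rewrite mulr_ge0// addr_ge0// mulr_ge0// divr_ge0// ltW.
Qed.

Lemma traded_kernel_ge0 (beta u : R) x : 0 <= u -> 0 <= beta - u ->
  0 <= traded_kernel beta u x.
Proof.
move=> u0 bu; apply: addr_ge0; first exact: mulr_ge0.
apply: mulr_ge0; last exact: step_weight_ge0.
exact: (mulr_ge0 trade_const_ge0).
Qed.

(** By Russo's formula the derivative in the traded amount is minus the [J]-weighted sum of pivotal
    probabilities plus [trade_const] times the step-weighted one, which [pivotal_comparison] makes
    nonnegative. *)
Lemma finite_comparison (beta u : R) : margin_closed L B e1 w0 -> 0 <= u -> b <= beta - u ->
  beta <= M -> trade_const * u <= b ->
  expect (p beta 0) (edges_in B) (fun w => ind (reaches T w o)) <=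
  expect (p beta u) (edges_in B) (fun w => ind (reaches T w o)).
Proof.
move=> HB u0 bu bM Kub.
set F := fun t => expect (p beta t) (edges_in B) (fun w => ind (reaches T w o)).
have SJ_ge0 := kernel_sum_ge0.
have K_ge0 := trade_const_ge0.
pose G (e : edge d) (t : R) := edge_weight (traded_kernel beta t) e.
pose dG (e : edge d) : R := - edge_weight J e + trade_const * edge_weight (step_weight e1) e.
have dGE (e : edge d) (t : R) : is_derive t (1 : R) (G e) (dG e).
  have -> : G e = (fun t => beta * edge_weight J e + t * dG e).
    by apply/funext => s; rewrite /G /dG /edge_weight /traded_kernel /GRing.scale /=; ring.
  have := @is_deriveD _ _ _ (cst (beta * edge_weight J e)) _ t 1 0 _ (is_derive_cst _ _ _)
    (@is_deriveM _ _ id (cst (dG e)) t 1 1 0 (is_derive_id _ _) (is_derive_cst _ _ _)).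
  by move/is_derive_eq; apply; rewrite add0r scaler0 add0r /GRing.scale /= mulr1.
have dF (t : R) : is_derive t (1 : R) F (\sum_(e <- edges_in B) dG e *
    expect (p beta t) (edges_in B) (fun w => (~~ w e)%:R *
      (ind (reaches T (setbit w e true) o) - ind (reaches T w o)))).
  by apply: (is_derive_expect (W := G)) => //; exact: edges_in_uniq.
have dF_ge0 (t : R) : 0 <= t -> t <= u -> 0 <= derive1 F t.
  move=> t0 tu; rewrite derive1E; have [_ ->] := dF t.
  have btt : b <= beta - t by rewrite (le_trans bu)// lerD2l lerN2.
  have bb : 0 < beta - t by exact: lt_le_trans btt.
  have Wt0 x : 0 <= traded_kernel beta t x.
    by apply: traded_kernel_ge0 => //; exact: ltW.
  have WtN x : traded_kernel beta t (- x) = traded_kernel beta t x.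
    by rewrite /traded_kernel JN step_weightN.
  have Wsum (r : seq V) : uniq r -> \sum_(x <- r) traded_kernel beta t x <= M * SJ + 2 * b.
    move=> ur; rewrite /traded_kernel big_split /= -!mulr_sumr; apply: lerD.
      apply: ler_pM => //; [exact: ltW|exact: sumr_ge0| |exact: J_sum].
      by rewrite lerBlDr (le_trans bM)// lerDl.
    rewrite mulrC; apply: ler_pM => //; first by apply: sumr_ge0 => x _; exact: step_weight_ge0.
    - exact: mulr_ge0.
    - exact: step_weight_sum.
    - by apply: le_trans Kub; rewrite ler_wpM2l.
  have JW x : J x <= b^-1 * traded_kernel beta t x.
    rewrite ler_pdivlMl// /traded_kernel.
    apply: (@le_trans _ _ ((beta - t) * J x)); first by rewrite ler_wpM2r.
    by rewrite lerDl mulr_ge0// ?step_weight_ge0// mulr_ge0.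
  have b'0 : 0 <= b^-1 by rewrite invr_ge0 ltW.
  have := pivotal_comparison o J_ge0 JN J_sum Wt0 WtN Wsum b'0 JW A_ge1 J_far J_near
    farN far0 far1 far_w0 e1_neq0 kappa_gt0 J_w0 HB.
  rewrite -/trade_const mulr_sumr -subr_ge0 -sumrB.
  move=> /le_trans; apply; rewrite le_eqVlt; apply/orP; left; apply/eqP.
  apply: eq_bigr => e _.
  rewrite (_ : expect _ _ (fun w => (~~ w e)%:R * _) =
      expect (p beta t) (edges_in B) (fun w => ind (edge_piv o L e w))).
    by rewrite /dG; ring.
  apply: eq_expect => w _.
  have mono : reaches T w o -> reaches T (setbit w e true) o.
    by apply: reaches_le => f; rewrite /setbit; case: eqP.
  case: (boolP (w e)) => we; rewrite ?mul0r ?mul1r.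
    rewrite indF//= => -[H1 H2]; apply: H1.
    rewrite (_ : setbit w e true = w) // in H2.
    by apply/funext => f; rewrite /setbit; case: eqP => // ->.
  have [H|H] := pselect (reaches T w o).
    by rewrite (indT H) (indT (mono H)) subrr indF// => -[].
  have [H'|H'] := pselect (reaches T (setbit w e true) o).
    by rewrite (indF H) (indT H') subr0 indT.
  by rewrite (indF H) (indF H') subr0 indF// => -[].
have derF x : derivable F x 1 by case: (dF x).
have := @ger0_derive1_le_cc R F 0 u _ _ _ 0 u.
apply; rewrite ?in_itv/= ?lexx ?u0//.
- by move=> x; rewrite in_itv /= => /andP[x0 xu]; apply: dF_ge0; exact: ltW.
- apply: continuous_subspaceT => x; apply: differentiable_continuous.
  exact/derivable1_diffP.
Qed.

End finite_comparison.

(** * Passage to infinite volume *)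

Section exhaustion.
Context {R : realType} {d : nat}.
Local Notation V := 'rV[int]_d.

Definition first_vertices (n : nat) : {fset V} :=
  seq_fset tt (pmap (@choice.unpickle V) (iota 0 n)).

Lemma mem_first_vertices n (x : V) : (choice.pickle x < n)%N -> x \in first_vertices n.
Proof.
move=> xn; rewrite seq_fsetE mem_pmap; apply/mapP; exists (choice.pickle x).
  by rewrite mem_iota.
by rewrite choice.pickleK.
Qed.

Lemma first_vertices_le m n x : (m <= n)%N -> x \in first_vertices m -> x \in first_vertices n.
Proof.
move=> mn; rewrite !seq_fsetE !mem_pmap => /mapP[k]; rewrite mem_iota => km ->.
by apply: map_f; rewrite mem_iota; lia.
Qed.

Lemma first_vertices_cover (s : seq V) : exists n, {subset s <= first_vertices n}.
Proof.
exists (\max_(x <- s) (choice.pickle x).+1) => x xs; apply: mem_first_vertices.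
by rewrite (big_rem x)//= leq_maxl.
Qed.

Definition reach_event (o : V) (T : set V) : set (config (edge d)) := [set w | reaches T w o].

Definition reach_within (o : V) (T : set V) (B : {fset V}) : set (config (edge d)) :=
  [set w | reaches T (restrict (edges_in B) w) o].

Lemma reach_within_sub o T B : reach_within o T B `<=` reach_event o T.
Proof. by move=> w; apply: reaches_le => e /andP[]. Qed.

(** An open path uses finitely many edges. The free margin [C] is there to hold [L] and its
    translates, so that [margin_closed] is true at every [m]. *)
Lemma reach_eventE o T (C : {fset V}) :
  reach_event o T = \bigcup_m reach_within o T (first_vertices m `|` C)%fset.
Proof.
apply/seteqP; split => [w [t Tt [p wp pt]]|w [m _]]; last exact: reach_within_sub.
have [m Hm] := first_vertices_cover (o :: p).
exists m => //; exists t => //; exists p => //.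
elim: p o wp {pt} Hm => [//|y p IH] x /= /andP[xy wp] Hm; apply/andP; split; last first.
  by apply: IH => // z zp; apply: Hm; rewrite inE zp orbT.
have /is_openP[e [E we _]] := xy; rewrite (is_openE _ E) /restrict we andbT.
by rewrite (mem_edges_inE _ E) !inE !Hm ?inE ?eqxx ?orbT.
Qed.

Lemma measurable_reach_within o T B : measurable (reach_within o T B).
Proof. exact: (measurable_restrict (fun w => reaches T w o) (edges_in_uniq B)). Qed.

Lemma measurable_reach_event o T : measurable (reach_event o T).
Proof.
by rewrite (reach_eventE o T fset0); apply: bigcupT_measurable => m; exact: measurable_reach_within.
Qed.

Lemma infinite_clusterE (o : V) : [set w : config (edge d) | infinite_set (open_cluster w o)] =
  \bigcap_n reach_event o (~` [set` first_vertices n]).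
Proof.
apply/seteqP; split => w /=.
  move=> inf n _; apply: contrapT => H; apply: inf.
  apply: (@sub_finite_set _ _ [set` first_vertices n]); last exact: finite_fset.
  by move=> x ox; apply: contrapT => xn; apply: H; exists x.
move=> H /finite_seqP[s Es]; have [n Hn] := first_vertices_cover s.
have [t /= Tt ot] := H n I; apply: Tt; apply: Hn.
by have : open_cluster w o t by []; rewrite Es.
Qed.

(** Two limits in this order: for fixed [L] the volume increases, giving continuity from below; then
    [L] exhausts the lattice, giving continuity from above. No uniformity of [C] in [L] is
    required. *)
Lemma le_infinite_cluster (P Q : probability (config (edge d)) R) (p q : edge d -> R) (o : V) :
  bernoulli_law P p -> bernoulli_law Q q ->
  (forall L : {fset V}, exists C : {fset V}, forall m,
    expect p (edges_in (first_vertices m `|` C)%fset) (fun w => ind (reaches (~` [set` L]) w o)) <=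
    expect q (edges_in (first_vertices m `|` C)%fset) (fun w => ind (reaches (~` [set` L]) w o))) ->
  (P [set w | infinite_set (open_cluster w o)] <= Q [set w | infinite_set (open_cluster w o)])%E.
Proof.
move=> Pp Qq H; rewrite infinite_clusterE.
set E := fun n => reach_event o (~` [set` first_vertices n]).
have mE n : measurable (E n) by exact: measurable_reach_event.
have PQ n : (P (E n) <= Q (E n))%E.
  have [C HC] := H (first_vertices n).
  rewrite {1}/E (reach_eventE _ _ C); set F := fun m => reach_within _ _ _.
  have mF m : measurable (F m) by exact: measurable_reach_within.
  have cvgF : P (F m) @[m --> \oo] --> P (\bigcup_m F m).
    apply: nondecreasing_cvg_mu => //; first exact: bigcupT_measurable.
    move=> m m' mm; apply/subsetPset => w; apply: reaches_le => e.
    rewrite /restrict !mem_edges_in !inE => /andP[/andP[s t] ->]; rewrite andbT.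
    by apply/andP; split; [move: s|move: t] => /orP[/(first_vertices_le mm)->|->]; rewrite ?orbT.
  rewrite -(cvg_lim _ cvgF)//; apply: lime_le; first by apply/cvg_ex; eexists; exact: cvgF.
  apply: nearW => m; apply: (@le_trans _ _ (Q (F m))).
    have EP : P (F m) = _ :=
      probability_restrict Pp (fun w => reaches _ w o) (edges_in_uniq _).
    have EQ : Q (F m) = _ :=
      probability_restrict Qq (fun w => reaches _ w o) (edges_in_uniq _).
    by rewrite EP EQ lee_fin HC.
  by apply: le_measure; rewrite ?inE//; exact: reach_within_sub.
have cvgE : Q (E n) @[n --> \oo] --> Q (\bigcap_n E n).
  apply: nonincreasing_cvg_mu => //.
  - by apply: (le_lt_trans (probability_le1 _ (mE _))); rewrite ltry.
  - exact: bigcapT_measurable.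
  - move=> m n mn; apply/subsetPset => w [t Tt ot]; exists t => //= tm.
    by apply: Tt => /=; exact: first_vertices_le tm.
rewrite -(cvg_lim _ cvgE)//; apply: lime_ge; first by apply/cvg_ex; eexists; exact: cvgE.
apply: nearW => n; apply: le_trans (PQ n).
apply: le_measure; rewrite ?inE//; first exact: bigcapT_measurable.
by move=> w; apply.
Qed.

End exhaustion.

(** * The strict inequality when the critical value is finite *)

Lemma absz_shift (t : int) (m : nat) : (absz t < m)%N ->
  (m <= absz (t + (2 * m)%:Z)%R)%N.
Proof. lia. Qed.

Section kernels.
Context {R : realType} {d : nat}.
Local Notation V := 'rV[int]_d.
Implicit Types (J : V -> R) (x : V).

Lemma enorm_perm (s : 'S_d) x : enorm R (col_perm s x) = enorm R x.
Proof.
rewrite /enorm [in RHS](reindex_inj (@perm_inj _ s)) /=; congr Num.sqrt.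
by apply: eq_bigr => i _; rewrite mxE.
Qed.

Lemma enorm_flip (i : 'I_d) x : enorm R (flip i x) = enorm R x.
Proof.
rewrite /enorm; congr Num.sqrt; apply: eq_bigr => j _; rewrite mxE.
by case: ifP => // _; rewrite mulrNz sqrrN.
Qed.

Lemma add_nn_symmetric J : symmetric_kernel J -> symmetric_kernel (add_nn J).
Proof.
move=> [Jp Jf]; split => [s x|i x]; rewrite /add_nn.
  by rewrite enorm_perm Jp.
by rewrite enorm_flip Jf.
Qed.

Lemma add_nn_ge J x : J x <= add_nn J x.
Proof. by rewrite /add_nn; case: ifP => // _; rewrite lerDl. Qed.

Lemma enorm_unit_vec (i : 'I_d) : enorm R (unit_vec i) = 1.
Proof.
rewrite /enorm (bigD1 i)//= big1 ?addr0.
  by rewrite !mxE !eqxx expr1n sqrtr1.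
by move=> j ji; rewrite !mxE (negbTE ji) andbF expr0n.
Qed.

Lemma enormN x : enorm R (- x) = enorm R x.
Proof.
rewrite /enorm; congr Num.sqrt; apply: eq_bigr => j _.
by rewrite mxE mulrNz sqrrN.
Qed.

Lemma enorm_coord x (i : 'I_d) : (absz (x 0%R i))%:R <= enorm R x.
Proof.
rewrite /enorm natr_absz intr_norm -sqrtr_sqr; apply: ler_wsqrtr.
by rewrite (bigD1 i)//= lerDl; apply: sumr_ge0 => j _; exact: sqr_ge0.
Qed.

Lemma integrable_kernel_sum J : (forall x, 0 <= J x) -> integrable_kernel J ->
  exists SJ : R, forall r : seq V, uniq r -> \sum_(x <- r) J x <= SJ.
Proof.
move=> J0 Jint; exists (fine (\esum_(x in [set: V]) (J x)%:E)%E) => r ur.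
rewrite -lee_fin fineK.
  rewrite -sumEFin; apply: esum_ge; exists [set` r].
    by split => //; exact: finite_seq.
  by rewrite fsbig_seq.
rewrite ge0_fin_numE//; apply: esum_ge0 => x _; by rewrite lee_fin.
Qed.

Lemma fin_lower_bound (I : finType) (F : I -> R) : (forall i, 0 < F i) ->
  exists2 c : R, 0 < c & forall i, c <= F i.
Proof.
move=> F0; have S0 : 0 <= \sum_i (F i)^-1.
  by apply: sumr_ge0 => i _; rewrite invr_ge0 ltW.
(* The summand 1 keeps the witness positive when [I] is empty. *)
exists (1 + \sum_i (F i)^-1)^-1; first by rewrite invr_gt0 ltr_pwDl.
move=> i; rewrite -[leRHS]invrK lef_pV2 ?posrE ?invr_gt0//; last by rewrite ltr_pwDl.
rewrite (bigD1 i)//= addrCA lerDl addr_ge0//.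
by apply: sumr_ge0 => j _; rewrite invr_ge0 ltW.
Qed.

Definition far (m : nat) (x : V) : bool := [exists i, (m <= absz (x 0%R i))%N].

Lemma near_lower_bound J (m : nat) (w : V) :
  (forall x, ~~ far m x -> 0 < J (x + w)) ->
  exists2 c : R, 0 < c & forall x, ~~ far m x -> c <= J (x + w).
Proof.
move=> H.
pose g (f : {ffun 'I_d -> 'I_(2 * m).+1}) : V := \row_i ((f i : nat)%:Z - m%:Z).
(* The coded box contains points with a coordinate of absolute value [m], which are far; they
   receive the harmless value 1. *)
pose F f := if far m (g f) then 1 else J (g f + w).
have [f|c c0 Hc] := @fin_lower_bound _ F; first by rewrite /F; case: ifPn => // /H.
exists c => // x nx; have nxi i : (absz (x 0%R i) < m)%N.
  by rewrite ltnNge; apply: contra nx => mi; apply/existsP; exists i.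
pose f := [ffun i => inord (absz (x 0%R i + m%:Z))] : {ffun 'I_d -> 'I_(2 * m).+1}.
have xE : g f = x.
  apply/rowP => i; rewrite mxE ffunE inordK; have := nxi i; lia.
by have := Hc f; rewrite /F xE (negbTE nx).
Qed.

End kernels.

Section strict_inequality.
Context {R : realType} {d : nat}.
Local Notation V := 'rV[int]_d.
Variables (J : V -> R) (i0 : 'I_d).
Hypothesis J_ge0 : forall x, 0 <= J x.
Hypothesis J_int : integrable_kernel J.
Hypothesis J_sym : symmetric_kernel J.
Hypothesis J_comp : exists a A : R, [/\ 0 < a, a < A &
  exists r : R, forall x : V, r <= enorm R x -> forall i : 'I_d,
    [/\ 0 < a * J (x + unit_vec i), a * J (x + unit_vec i) <= J x &
        J x <= A * J (x + unit_vec i)]].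

Lemma percolation_trade (b M : R) : 0 < b ->
  exists2 K : R, 0 <= K & forall beta u : R, 0 <= u -> b <= beta - u -> beta <= M -> K * u <= b ->
    (percolation beta J [set w | infinite_set (open_cluster w 0%R)] <=
     percolation (beta - u) (add_nn J) [set w | infinite_set (open_cluster w 0%R)])%E.
Proof.
move=> b0; have JN := symmetric_kernelN J_sym.
have [SJ J_sum] := integrable_kernel_sum J_ge0 J_int.
have [a [A [a0 aA [r Hr]]]] := J_comp.
have SJ_ge0 : 0 <= SJ by have := @J_sum [::] isT; rewrite big_nil.
have J_le x : J x <= SJ by have := @J_sum [:: x] isT; rewrite big_seq1.
(* Large enough that a coordinate of size [m] forces norm at least [r], and at least 2 so that [e1]
   is near. *)
pose m := (2 + Num.bound `|r|)%N.
have far_r x : far m x -> r <= enorm R x.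
  move=> /existsP[i mi]; apply: le_trans (enorm_coord x i).
  apply: (le_trans (ler_norm r)); apply: (@le_trans _ _ (Num.bound `|r|)%:R).
    by rewrite ltW// archi_boundP.
  by rewrite ler_nat (leq_trans _ mi)// leq_addl.
pose e1 : V := unit_vec i0.
pose w0 : V := e1 *+ (2 * m).
have w0E : w0 0 i0 = (2 * m)%:Z by rewrite /w0 mulmxnE mxE !eqxx /= ?natz.
have near_far x : ~~ far m x -> far m (x + w0).
  move=> nx; apply/existsP; exists i0; rewrite mxE w0E.
  apply: absz_shift; rewrite ltnNge; apply: contra nx => mi.
  by apply/existsP; exists i0.
have far_gt0 x : far m x -> 0 < J x.
  by move=> /far_r/Hr/(_ i0)[J0 J1 _]; exact: lt_le_trans J1.
have [kappa kappa0 Hkappa] := @near_lower_bound R d J m w0 (fun x nx => far_gt0 _ (near_far x nx)).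
have far0 : ~~ far m (0 : V).
  by apply/existsPn => i; rewrite mxE.
have far1 : ~~ far m e1.
  by apply/existsPn => i; rewrite mxE; case: (_ && _).
have far_w0 : far m w0 by have := near_far _ far0; rewrite add0r.
have farN (x : V) : far m (- x) = far m x.
  by apply: eq_existsb => i; rewrite mxE abszN.
have e1_neq0 : e1 != 0.
  apply/eqP => /rowP/(_ i0); rewrite !mxE !eqxx.
  by [].
(* The three summands give [A' >= 1], the comparison of far points with [A], and that of near
   points, where [J x <= SJ] and [J (x + w0) >= kappa]. *)
pose A' := 1 + `|A| + SJ / kappa.
have SJk : 0 <= SJ / kappa by rewrite divr_ge0// ltW.
have A'1 : 1 <= A' by rewrite /A' -addrA lerDl addr_ge0.
have J_far x : far m x -> J x <= A' * J (x + e1).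
  move=> /far_r/Hr/(_ i0)[_ _] /le_trans; apply; rewrite ler_wpM2r//.
  apply: (le_trans (ler_norm A)); rewrite /A'; lra.
have J_near x : ~~ far m x -> J x <= A' * J (x + w0).
  move=> nx; apply: (le_trans (J_le x)); apply: (@le_trans _ _ (SJ / kappa * J (x + w0))).
    by rewrite mulrAC ler_pdivlMr// ler_wpM2l// Hkappa.
  by rewrite ler_wpM2r// /A' lerDr addr_ge0.
have J_w0 : kappa <= J w0 by have := Hkappa _ far0; rewrite add0r.
exists `|trade_const SJ A' kappa b M| => // beta u u0 bu bM Ku.
have {}Ku : trade_const SJ A' kappa b M * u <= b.
  by apply: le_trans Ku; rewrite ler_wpM2r// ler_norm.
have beta0 : 0 <= beta by rewrite -(subrK u beta) addr_ge0// (le_trans _ bu)// ltW.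
have bu0 : 0 <= beta - u by rewrite (le_trans _ bu)// ltW.
have nnN := symmetric_kernelN (add_nn_symmetric J_sym).
have nn0 x : 0 <= add_nn J x by apply: le_trans (add_nn_ge J x).
apply: le_infinite_cluster.
- exact: (bernoulli_percolation (percolationP beta0 J_ge0 J_sym)).
- exact: (bernoulli_percolation (percolationP bu0 nn0 (add_nn_symmetric J_sym))).
move=> L; exists (seq_fset tt (flatten [seq [:: x; x + e1; x + w0; x + w0 + e1] | x <- L])) => n.
set B := (_ `|` _)%fset.
have HB : margin_closed L B e1 w0.
  move=> x xL; have H y : y \in [:: x; x + e1; x + w0; x + w0 + e1] -> y \in B.
    move=> yx; rewrite in_fsetU; apply/orP; right; rewrite seq_fsetE; apply/flattenP.
    by exists [:: x; x + e1; x + w0; x + w0 + e1] => //; apply: map_f.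
  by split; apply: H; rewrite !inE eqxx ?orbT.
have := finite_comparison 0 J_ge0 JN J_sum A'1 J_far J_near farN far0 far1 far_w0
  e1_neq0 kappa0 J_w0 b0 HB u0 bu bM Ku.
set p0 := fun e : edge d => 1 - _.
have -> : p0 = (fun e => 1 - expR (- (beta * edge_weight J e))).
  apply/funext => e; rewrite /p0 /edge_weight /traded_kernel.
  by rewrite subr0 mulr0 mul0r addr0.
move=> /le_trans; apply.
have tk0 x : 0 <= traded_kernel J SJ A' kappa b M e1 beta u x.
  exact: (traded_kernel_ge0 M e1 J_ge0 J_sum A'1 kappa0 b0).
apply: expect_mono.
- exact: open_probability_itv.
- have /open_probability_itv H : forall x, 0 <= (beta - u) * add_nn J x.
    by move=> x; rewrite mulr_ge0.
  exact: H.
- move=> e; rewrite lerD2l lerN2 ler_expR lerN2 /edge_weight /traded_kernel.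
  set v := src e - tgt e; rewrite /step_weight.
  (* The unit added at a neighbour has weight [beta - u] in [add_nn J], and this pays for the step
     weight: [trade_const * u <= b <= beta - u]. *)
  case: (eqVneq v e1) => [->|v1] /=; first by rewrite /add_nn enorm_unit_vec eqxx mulrDr !mulr1 lerD2l (le_trans Ku).
  case: (eqVneq v (- e1)) => [->|v2] /=.
    by rewrite /add_nn enormN enorm_unit_vec eqxx mulrDr !mulr1 lerD2l (le_trans Ku).
  by rewrite mulr0 addr0 ler_wpM2l//; exact: (add_nn_ge J v).
- move=> w w' ww'; apply: le_ind; exact: reaches_le.
Qed.

(** Some [beta] in [[b, b + u)] percolates for [J]; the trade shows that [beta - u], which is below
    [b], percolates for [add_nn J]. *)
Lemma beta_c_lt_add_nn (b : R) : beta_c J = b%:E -> 0 < b -> (beta_c (add_nn J) < beta_c J)%E.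
Proof.
move=> Jb b0; have b20 : 0 < b / 2 by rewrite divr_gt0.
have [K K0 HK] := @percolation_trade (b / 2) (b + 1) b20.
(* The bounds ensure [beta - u >= b / 2], [beta <= b + 1] and [K * u <= b / 2]; dividing by [K + 1]
   allows [K = 0]. *)
pose u := Num.min (Num.min (b / 2) 1) (b / 2 / (K + 1)).
have K1 : 0 < K + 1 by rewrite ltr_wpDl.
have u0 : 0 < u by rewrite /u !lt_min b20 ltr01 divr_gt0.
have u1 : u <= b / 2 by rewrite /u !ge_min lexx.
have u2 : u <= 1 by rewrite /u !ge_min lexx orbT.
have u3 : K * u <= b / 2.
  apply: (@le_trans _ _ ((K + 1) * u)); first by rewrite ler_wpM2r ?(ltW u0)// lerDl.
  by rewrite mulrC -ler_pdivlMr// /u ge_min lexx orbT.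
have : (beta_c J < (b + u)%:E)%E by rewrite Jb lte_fin ltrDl.
move=> /ereal_inf_lt[_ [beta [beta0 Pbeta] <-]]; rewrite lte_fin => betau.
have bbeta : b <= beta.
  by rewrite -lee_fin -Jb; apply: ereal_inf_lbound; exists beta.
rewrite Jb; apply: (@le_lt_trans _ _ (beta - u)%:E); last by rewrite lte_fin; lra.
apply: ereal_inf_lbound; exists (beta - u) => //; split; first lra.
by apply: (lt_le_trans Pbeta); apply: HK; lra.
Qed.

End strict_inequality.

(** * Positivity of the critical value *)

Lemma sum_half_le2 {R : realType} n : \sum_(0 <= k < n) (1 / 2) ^+ k <= 2 :> R.
Proof.
suff -> : \sum_(0 <= k < n) (1 / 2) ^+ k = 2 - 2 * (1 / 2) ^+ n :> R.
  by rewrite lerBlDr lerDl mulr_ge0// exprn_ge0//; lra.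
elim: n => [|k IH]; first by rewrite big_geq// expr0; lra.
by rewrite big_nat_recr//= IH exprS; field.
Qed.

Section self_avoiding_paths.
Context {R : realType} {d : nat}.
Local Notation V := 'rV[int]_d.
Variables (J : V -> R) (SJ beta : R).
Hypothesis J_ge0 : forall x, 0 <= J x.
Hypothesis JN : forall x : V, J (- x) = J x.
Hypothesis J_sum : forall r : seq V, uniq r -> \sum_(x <- r) J x <= SJ.
Hypothesis beta_ge0 : 0 <= beta.
Hypothesis beta_small : beta * SJ <= 1 / 2.

Fixpoint path_weight (x : V) (q : seq V) : R :=
  if q is y :: q' then beta * J (x - y) * path_weight y q' else 1.

Lemma path_weight_ge0 x q : 0 <= path_weight x q.
Proof. by elim: q x => //= y q IH x; rewrite !mulr_ge0. Qed.

Fixpoint steps (x : V) (q : seq V) : seq (V * V) :=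
  if q is y :: q' then (x, y) :: steps y q' else [::].

Lemma path_steps (w : config (edge d)) x q :
  path (is_open w) x q = all (fun e => is_open w e.1 e.2) (steps x q).
Proof. by elim: q x => //= y q IH x; rewrite IH. Qed.

Lemma mem_steps x q f : f \in steps x q -> f.1 \in x :: q /\ f.2 \in x :: q.
Proof.
elim: q x => //= y q IH x; rewrite inE => /predU1P[->|/IH[f1 f2]] /=.
  by rewrite !inE !eqxx orbT.
by rewrite in_cons f1 in_cons f2 !orbT.
Qed.

Lemma steps_uniq x q : uniq (x :: q) ->
  all (fun f => f.1 != f.2) (steps x q) /\
  uniq [seq [fset f.1; f.2]%fset | f <- steps x q].
Proof.
elim: q x => //= y q IH x /andP[xq yq]; have [H1 H2] := IH _ yq; split.
  by rewrite H1 andbT; apply: contra xq => /eqP ->; rewrite mem_head.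
rewrite H2 andbT; apply/mapP => -[f /mem_steps[f1 f2]] /fset2_inj[[E _]|[E _]].
  by rewrite E f1 in xq.
by rewrite E f2 in xq.
Qed.

(** A self-avoiding path has distinct edges, so its probability is a product of factors
    [1 - exp (- t) <= t]. *)
Lemma path_probability (P : probability (config (edge d)) R) x q :
  percolation_law beta J P -> uniq (x :: q) ->
  (P [set w | path (is_open w) x q] <= (path_weight x q)%:E)%E.
Proof.
move=> PJ /steps_uniq[H1 H2]; under eq_set do rewrite path_steps.
rewrite PJ// lee_fin {H1 H2}; elim: q x => [|y q IH] x /=; first by rewrite big_nil.
rewrite big_cons; apply: ler_pM => //.
- rewrite subr_ge0 -expR0 ler_expR oppr_le0; exact: mulr_ge0.
- by apply: prodr_ge0 => f _; rewrite subr_ge0 -expR0 ler_expR oppr_le0 mulr_ge0.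
- by have := expR_ge1Dx (- (beta * J (x - y))); rewrite /=; lra.
Qed.

Fixpoint words (U : seq V) (k : nat) : seq (seq V) :=
  if k is k'.+1 then [seq x :: q | x <- U, q <- words U k'] else [:: [::]].

Lemma mem_words U k q : size q = k -> {subset q <= U} -> q \in words U k.
Proof.
elim: k q => [|k IH] [|x q]//= [sq] qU; apply/allpairsP; exists (x, q) => /=; split => //.
  by apply: qU; rewrite mem_head.
by apply: IH => // y yq; apply: qU; rewrite inE yq orbT.
Qed.

Lemma size_words U k q : q \in words U k -> size q = k.
Proof. by elim: k q => [|k IH] q /=; [rewrite inE => /eqP ->|move=> /allpairsP[[x p] /= [_ /IH <- ->]]]. Qed.

Lemma words_uniq U k : uniq U -> uniq (words U k).
Proof.
by move=> uU; elim: k => //= k IH; apply: allpairs_uniq => // -[x q] [y p] _ _ /= [-> ->].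
Qed.

Lemma sum_words U k x : uniq U ->
  \sum_(q <- words U k) path_weight x q <= (1 / 2) ^+ k.
Proof.
move=> uU; elim: k x => [|k IH] x /=; first by rewrite big_seq1 expr0.
rewrite big_allpairs_dep /=; under eq_bigr do rewrite -mulr_sumr.
apply: (@le_trans _ _ (\sum_(y <- U) beta * J (x - y) * (1 / 2) ^+ k)).
  by apply: ler_sum => y _; rewrite ler_wpM2l// mulr_ge0.
rewrite -mulr_suml -mulr_sumr exprS ler_wpM2r// ?exprn_ge0//; try lra.
apply: le_trans beta_small; rewrite ler_wpM2l// -(big_map (fun y => x - y) xpredT J).
by apply: J_sum; rewrite map_inj_uniq// => y y' /addrI/oppr_inj.
Qed.

(** Grouped by length, the paths of length [k] over a finite alphabet weigh at most
    [(1 / 2) ^+ k]. *)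
Lemma sum_path_weight (s : seq (seq V)) x : uniq s ->
  \sum_(q <- s) path_weight x q <= 2.
Proof.
move=> us; pose U := undup (flatten s); pose n := \max_(q <- s) (size q).+1.
pose t := flatten [seq words U k | k <- iota 0 n].
apply: (@le_trans _ _ (\sum_(q <- t) path_weight x q)).
  apply: (@sum_le_inj _ _ _ _ _ id) => //; last by move=> q; exact: path_weight_ge0.
    suff H m : uniq (flatten [seq words U k | k <- iota m n]) by exact: H.
    elim: n {t} m => //= n IH m; rewrite cat_uniq words_uniq ?undup_uniq//= IH andbT.
    apply/hasPn => q /flattenP[l /mapP[k]]; rewrite mem_iota => km -> /size_words sq.
    by apply/negP => /size_words; lia.
  move=> q qs; apply/flattenP; exists (words U (size q)).
    apply: map_f; rewrite mem_iota /= add0n /n (big_rem q)//= leq_max ltnSn//.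
  by apply: mem_words => // y yq; rewrite mem_undup; apply/flattenP; exists q.
rewrite /t big_flatten big_map /=.
apply: (@le_trans _ _ (\sum_(k <- iota 0 n) (1 / 2) ^+ k)).
  by apply: ler_sum => k _; apply: sum_words; exact: undup_uniq.
by have := @sum_half_le2 R n; rewrite /index_iota subn0.
Qed.

(** Borel-Cantelli: each vertex of the cluster ends an open self-avoiding path from [o], so an
    infinite cluster requires infinitely many such paths, whose expected number is at most 2. *)
Lemma no_percolation_small (P : probability (config (edge d)) R) o :
  percolation_law beta J P -> P [set w | infinite_set (open_cluster w o)] = 0%E.
Proof.
(* With [pickle_inv] each path has only one code, so the sum runs over distinct paths. *)
move=> PJ; pose dec (n : nat) : option (seq V) := choice.pickle_inv n.
pose A (n : nat) : set (config (edge d)) :=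
  [set w | exists2 q, dec n = Some q & uniq (o :: q) && path (is_open w) o q].
have mA n : measurable (A n).
  rewrite /A; case: (dec n) => [q|]; last first.
    by rewrite (_ : [set _ | _] = set0); [exact: measurable0|apply/seteqP; split => w // []].
  case uq: (uniq (o :: q)); last first.
    rewrite (_ : [set _ | _] = set0); first exact: measurable0.
    by apply/seteqP; split => w // -[_ [<-]] /andP[uq' _]; case: (negP (negbT uq) uq').
  rewrite (_ : [set _ | _] = [set w | all (fun e => is_open w e.1 e.2) (steps o q)]).
    exact: measurable_all_open.
  apply/seteqP; split => w /=; rewrite -path_steps; first by move=> [_ [<-]] /andP[].
  by move=> wq; exists q => //; rewrite wq andbT.
pose G n : R := oapp (path_weight o) 0 (dec n).
have PA n : (P (A n) <= (G n)%:E)%E.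
  rewrite /A /G; case: (dec n) => [q|] /=; last first.
    by rewrite (_ : [set _ | _] = set0) ?measure0//; apply/seteqP; split => w // [].
  case uq: (uniq (o :: q)); last first.
    rewrite (_ : [set _ | _] = set0) ?measure0 ?lee_fin ?path_weight_ge0//.
    by apply/seteqP; split => w // -[_ [<-]] /andP[uq' _]; case: (negP (negbT uq) uq').
  rewrite (_ : [set _ | _] = [set w | path (is_open w) o q]).
    exact: path_probability.
  apply/seteqP; split => w /=; first by move=> [_ [<-]] /andP[].
  by move=> wq; exists q => //; rewrite wq andbT.
have sumA : (\sum_(n <oo) P (A n) < +oo)%E.
  apply: (@le_lt_trans _ _ 2%:E); last exact: ltry.
  apply: lime_le; first exact: is_cvg_nneseries.
  apply: nearW => n; apply: (@le_trans _ _ (\sum_(0 <= k < n) (G k)%:E)%E).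
    by apply: lee_sum => k _; exact: PA.
  rewrite sumEFin lee_fin.
  have -> : \sum_(0 <= k < n) G k = \sum_(q <- pmap dec (iota 0 n)) path_weight o q.
    rewrite /index_iota subn0; elim: (iota 0 n) => [|k l IH]; first by rewrite !big_nil.
    rewrite big_cons /= IH /G; case: (dec k) => [q|] /=; last by rewrite add0r.
    by rewrite big_cons.
  by apply: sum_path_weight; apply: pmap_uniq (iota_uniq _ _); exact: choice.pickle_invK.
apply/eqP; rewrite eq_le measure_ge0 andbT -(lim_sup_set_cvg0 mA sumA).
apply: le_measure; rewrite ?inE.
- exact: measurable_infinite_cluster.
- by apply: bigcapT_measurable => n; apply: bigcup_measurable => k _; exact: mA.
move=> w inf n _; apply: contrapT => H; apply: inf.
apply: (@sub_finite_set _ _ [set` [seq last o q | q <- pmap dec (iota 0 n)]]); last exact: finite_seq.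
move=> y [p wp <-] /=; case/shortenP: wp => q wq uq _.
have dq : dec (choice.pickle q) = Some q by exact: choice.pickleK_inv.
apply: map_f; rewrite mem_pmap; apply/mapP; exists (choice.pickle q) => //.
rewrite mem_iota /= add0n ltnNge; apply/negP => nq; apply: H.
by exists (choice.pickle q) => //; exists q => //; rewrite uq.
Qed.

End self_avoiding_paths.

Lemma beta_c_gt0 {R : realType} {d : nat} (J : 'rV[int]_d -> R) :
  (forall x, 0 <= J x) -> integrable_kernel J -> symmetric_kernel J -> (0 < beta_c J)%E.
Proof.
move=> J0 Jint Jsym; have [SJ J_sum] := integrable_kernel_sum J0 Jint.
have SJ0 : 0 <= SJ by have := @J_sum [::] isT; rewrite big_nil.
pose c := 1 / (2 * (SJ + 1)).
have S1 : 0 < 2 * (SJ + 1) by lra.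
have c0 : 0 < c by rewrite divr_gt0.
apply: (@lt_le_trans _ _ c%:E); first by rewrite lte_fin.
apply: le_ereal_inf_tmp => _ [beta [beta0 Pbeta] <-]; rewrite lee_fin leNgt.
apply/negP => betac; move: Pbeta.
rewrite (@no_percolation_small _ _ J SJ beta) ?ltxx//; last exact: percolationP.
move: betac; rewrite /c ltr_pdivlMr// => H; nra.
Qed.

(** * Renormalization in the quadrant *)

Section boxes.
Local Notation pt := (nat * nat)%type.

(** Locked, lest simplification expand the nine pairs. *)
Definition children (c : pt) : seq pt :=
  locked [seq ((3 * c.1 + i)%N, (3 * c.2 + j)%N) | i <- iota 0 3, j <- iota 0 3].

Definition parent (c : pt) : pt := ((c.1 %/ 3)%N, (c.2 %/ 3)%N).

Lemma mem_children (c c' : pt) : (c' \in children c) = (parent c' == c).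
Proof.
rewrite /children -lock; case: c c' => [a b] [a' b']; apply/idP/eqP.
  move=> /allpairsP[[i j] [+ + [-> ->]]]; rewrite !mem_iota /parent /= => i3 j3.
  by congr pair; lia.
move=> -[<- <-]; apply/allpairsP; exists ((a' %% 3)%N, (b' %% 3)%N).
by rewrite !mem_iota /=; split; [lia|lia|congr pair; lia].
Qed.

Lemma size_children c : size (children c) = 9.
Proof. by rewrite /children -lock. Qed.

Lemma children_uniq c : uniq (children c).
Proof.
by rewrite /children -lock; apply: allpairs_uniq => // -[i j] [i' j'] _ _ /= [/addnI -> /addnI ->].
Qed.

Definition ancestor (k : nat) : pt -> pt := iter k parent.

Fixpoint box (k : nat) (c : pt) : seq pt :=
  if k is k'.+1 then flatten [seq box k' c' | c' <- children c] else [:: c].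

Lemma mem_box k c v : ancestor k v = c -> v \in box k c.
Proof.
elim: k c => [|k IH] c /=; first by move=> ->; rewrite mem_head.
move=> H; apply/flattenP; exists (box k (ancestor k v)); last exact: IH.
by apply: map_f; rewrite mem_children; apply/eqP.
Qed.

Variables (E : eqType) (owned : pt -> seq E).

(* Level [k] is that of the boxes of side [3 ^ k]. *)
Fixpoint bad (k : nat) (c : pt) (w : E -> bool) : bool :=
  if k is k'.+1 then (1 < count (fun c' => bad k' c' w) (children c))%N
  else ~~ all w (owned c).

Lemma bad_two k c c1 c2 w : c1 \in children c -> c2 \in children c -> c1 != c2 ->
  bad k c1 w -> bad k c2 w -> bad k.+1 c w.
Proof.
move=> c1c c2c c12 b1 b2 /=; rewrite -size_filter.
apply: (@uniq_leq_size _ [:: c1; c2]); first by rewrite /= inE c12.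
by move=> x; rewrite !inE mem_filter => /orP[]/eqP ->; apply/andP.
Qed.

Lemma badP k c w : bad k.+1 c w ->
  exists c1 c2, [/\ c1 \in children c, c2 \in children c, c1 != c2, bad k c1 w & bad k c2 w].
Proof.
rewrite /= -size_filter.
have : uniq [seq c' <- children c | bad k c' w] by rewrite filter_uniq// children_uniq.
have : {subset [seq c' <- children c | bad k c' w] <= [seq c' <- children c | bad k c' w]} by [].
case: {1 3 4}[seq c' <- children c | bad k c' w] => [|c1 [|c2 s]]//= H /andP[c1s _] _.
have := H c1; have := H c2; rewrite !inE !eqxx ?orbT !mem_filter.
move=> /(_ isT)/andP[? ?] /(_ isT)/andP[? ?]; exists c1, c2; split => //.
by move: c1s; rewrite inE negb_or => /andP[].
Qed.

Lemma bad_local k c w w' : (forall v, ancestor k v = c -> {in owned v, w =1 w'}) ->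
  bad k c w = bad k c w'.
Proof.
elim: k c => [|k IH] c H /=.
  by congr (~~ _); apply: eq_in_all => e ec; apply: H ec.
congr (1 < _)%N; apply: eq_in_count => c' c'c; apply: IH => v vc'; apply: H => /=.
by rewrite vc'; move: c'c; rewrite mem_children => /eqP.
Qed.

(** * Probability of a bad box *)

Section probability.
Context {R : realType}.
Variables (p : E -> R) (s : seq E) (eps : R).
Hypothesis p01 : forall e, 0 <= p e <= 1.
Hypothesis s_uniq : uniq s.
Hypothesis size_owned : forall v, (size (owned v) <= 2)%N.
Hypothesis owned_inj : forall v v' e, e \in owned v -> e \in owned v' -> v = v'.
Hypothesis p_owned : forall v e, e \in owned v -> 1 - p e <= eps.
Hypothesis eps_ge0 : 0 <= eps.

Lemma expect_coordinate e : e \in s -> expect p s (fun w => (~~ w e)%:R) = 1 - p e.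
Proof.
move=> es; pose F (f : E) (b : bool) : R := if f == e then (~~ b)%:R else 1.
transitivity (expect p s (fun w => \prod_(f <- s) F f (w f))).
  apply: eq_expect => w _; rewrite (bigD1_seq e)//= /F eqxx big1 ?mulr1// => f /negbTE.
  by move=> ->.
rewrite expect_prod// (bigD1_seq e)//= /F eqxx big1 ?mulr1 ?mulr0 ?add0r// => f /negbTE.
by move=> ->; ring.
Qed.

Fixpoint bad_bound (k : nat) : R := if k is k'.+1 then 81 * bad_bound k' ^+ 2 else 2 * eps.

Lemma bad_bound_ge0 k : 0 <= bad_bound k.
Proof. by case: k => [|k] /=; rewrite mulr_ge0// exprn_even_ge0. Qed.

(** A single site is bad when one of its at most two edges is closed. A larger bad box contains two
    distinct bad children, which depend on disjoint sets of edges and are thus independent; there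
    are at most 81 ordered pairs. *)
Lemma bad_probability k c : (forall v, ancestor k v = c -> {subset owned v <= s}) ->
  expect p s (fun w => (bad k c w)%:R) <= bad_bound k.
Proof.
elim: k c => [|k IH] c Hs /=.
  have os := Hs c erefl.
  apply: (@le_trans _ _ (expect p s (fun w => \sum_(e <- owned c) (~~ w e)%:R))).
    apply: le_expect => // w _; elim: (owned c) => [|e l IHl] /=; first by rewrite big_nil.
    rewrite big_cons; case: (w e) => /=; first by rewrite add0r.
    by rewrite lerDl; apply: sumr_ge0 => f _; exact: ler0n.
  rewrite expect_sum; apply: (@le_trans _ _ (\sum_(e <- owned c) eps)).
    rewrite big_seq [leRHS]big_seq; apply: ler_sum => e ec.
    by rewrite expect_coordinate ?os//; exact: p_owned ec.
  rewrite big_const_seq iter_addr_0 count_predT -[X in X <= _]mulr_natl ler_wpM2r// ler_nat.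
  exact: size_owned.
have child v c' : c' \in children c -> ancestor k v = c' -> ancestor k.+1 v = c.
  by rewrite mem_children => /eqP <- <-.
pose cc := [seq c12 <- [seq (c1, c2) | c1 <- children c, c2 <- children c] | c12.1 != c12.2].
apply: (@le_trans _ _ (expect p s (fun w => \sum_(c12 <- cc) (bad k c12.1 w)%:R * (bad k c12.2 w)%:R))).
  apply: le_expect => // w _; case: (boolP (1 < _)%N) => [/badP|_]; last first.
    by apply: sumr_ge0 => f _; rewrite mulr_ge0.
  move=> [c1 [c2 [c1c c2c c12 b1 b2]]].
  have cin : (c1, c2) \in cc by rewrite mem_filter c12; apply/allpairsP; exists (c1, c2).
  rewrite (big_rem _ cin)/= b1 b2 mulr1 lerDl.
  by apply: sumr_ge0 => f _; rewrite mulr_ge0.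
rewrite expect_sum; apply: (@le_trans _ _ (\sum_(c12 <- cc) bad_bound k ^+ 2)).
  rewrite big_seq [leRHS]big_seq; apply: ler_sum => -[c1 c2].
  rewrite mem_filter => /andP[/= c12 /allpairsP[[d1 d2] /= [c1c c2c [E1 E2]]]]; subst d1 d2.
  pose Q e := `[< exists2 v, ancestor k v = c2 & e \in owned v >].
  rewrite (@expect_indep _ _ _ _ Q).
  - rewrite expr2; apply: ler_pM; try by apply: expect_ge0.
      by apply: IH => v vc; apply: Hs; exact: child vc.
    by apply: IH => v vc; apply: Hs; exact: child vc.
  - move=> w e b /asboolP[v vc2 ev]; congr ((nat_of_bool _)%:R); apply: bad_local => v' v'c1 f fv'.
    rewrite /setbit; case: eqVneq => // fe; move: c12.
    by rewrite -vc2 -v'c1 (owned_inj ev (v' := v')) ?eqxx// -fe.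
  - move=> w e b /asboolPn He; congr ((nat_of_bool _)%:R); apply: bad_local => v' v'c2 f fv'.
    rewrite /setbit; case: eqVneq => // fe; exfalso; apply: He.
    by exists v' => //; rewrite -fe.
rewrite big_const_seq iter_addr_0 count_predT -[X in X <= _]mulr_natl ler_wpM2r ?exprn_even_ge0//.
by rewrite ler_nat size_filter (leq_trans (count_size _ _))// size_allpairs size_children.
Qed.

(** With [x_k = 81 * bad_bound k] the recursion is [x_(k+1) = x_k ^ 2]; 648 is chosen so that
    [x_0 <= 1 / 4], which gives decay [(1 / 4) ^+ k.+1]. *)
Lemma bad_bound_le k : eps <= 1 / 648 -> bad_bound k <= (1 / 81) * (1 / 2) ^+ k.
Proof.
move=> e648; apply: (@le_trans _ _ ((1 / 81) * (1 / 4) ^+ k.+1)).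
  elim: k => [|k IH] /=; first by rewrite expr1; lra.
  set a := (1 / 4) ^+ k.+1 in IH *; have B0 := bad_bound_ge0 k.
  have a0 : 0 <= a by rewrite exprn_ge0//; lra.
  have a1 : a <= 1 / 4.
    by rewrite /a exprS ler_piMr// exprn_ile1//; lra.
  rewrite [X in _ <= _ * X]exprS -/a; move: IH B0; move: (bad_bound k) => y ya y0.
  have H1 : y * y <= (1 / 81 * a) * (1 / 81 * a) by apply: ler_pM.
  have H2 : a * a <= 1 / 4 * a by rewrite ler_wpM2r.
  by rewrite expr2; lra.
apply: ler_wpM2l; first lra.
apply: (@le_trans _ _ ((1 / 4) ^+ k)).
  by rewrite exprS ler_piMl ?exprn_ge0//; lra.
by apply: lerXn2r; rewrite ?nnegrE; lra.
Qed.

End probability.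

(** * Connected cores of good boxes *)

Section geometry.
Variables (T : Type) (conn : T -> T -> Prop) (site : pt -> T) (w : E -> bool).
Hypothesis conn_refl : forall x, conn x x.
Hypothesis connC : forall x y, conn x y -> conn y x.
Hypothesis conn_trans : forall x y z, conn x y -> conn y z -> conn x z.
Hypothesis conn_right : forall v, all w (owned v) -> conn (site v) (site (v.1.+1, v.2)).
Hypothesis conn_up : forall v, all w (owned v) -> conn (site v) (site (v.1, v.2.+1)).

(** The sites of the box all of whose enclosing subboxes at levels below [k] are good; the box
    itself is not asked to be good. *)
Fixpoint core (k : nat) (c v : pt) : Prop :=
  if k is k'.+1 then exists c', [/\ c' \in children c, ~~ bad k' c' w & core k' c' v]
  else v = c.

Definition core_conn k c c' := forall v v', core k c v -> core k c' v' -> conn (site v) (site v').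

Lemma core_connC k c c' : core_conn k c c' -> core_conn k c' c.
Proof. by move=> H v v' cv cv'; apply: connC; exact: H. Qed.

Definition grid : seq pt := [seq (i, j) | i <- iota 0 3, j <- iota 0 3].

Arguments grid : simpl never.

Definition next_box (x y : pt) : bool := (y == (x.1.+1, x.2)) || (y == (x.1, x.2.+1)).

(** One round of breadth-first search avoiding [b]; with nine cells, eight rounds reach everything
    reachable. *)
Definition grow (b : pt) (S : seq pt) : seq pt :=
  [seq z <- grid | (z \in S) || (z != b) && has (fun x => next_box x z || next_box z x) S].

(* [b] is the removed vertex; [(3, 3)] lies outside the grid: nothing is removed. *)
Lemma grid_connected b x y : b \in (3, 3)%N :: grid -> x \in grid -> y \in grid ->
  x != b -> y != b -> y \in iter 8 (grow b) [:: x].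
Proof.
have : all (fun b => all (fun x => all (fun y => (x != b) ==> (y != b) ==>
    (y \in iter 8 (grow b) [:: x])) grid) grid) ((3, 3)%N :: grid) by vm_compute.
by move=> /allP H /H/allP H' /H'/allP H'' /H''/implyP H3 /H3/implyP.
Qed.

Definition child (c x : pt) : pt := ((3 * c.1 + x.1)%N, (3 * c.2 + x.2)%N).

Lemma childP c c' : reflect (exists2 x, x \in grid & c' = child c x) (c' \in children c).
Proof.
rewrite /children -lock.
apply: (iffP allpairsP) => [[[i j] /= [iI jI ->]]|[[i j] /allpairsP[[i' j'] /= [iI jI [-> ->]]] ->]].
  by exists (i, j) => //; apply/allpairsP; exists (i, j).
by exists (i', j').
Qed.

Lemma child_in c x : x \in grid -> child c x \in children c.
Proof. by move=> xg; apply/childP; exists x. Qed.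

(** The two claims are proved together. Inside a good box, adjacent good children have joined cores
    and the grid without one cell is connected; two adjacent good boxes are joined through a facing
    pair of good children. *)
Lemma core_connected k :
  (forall c, ~~ bad k c w -> (exists v, core k c v) /\ core_conn k c c) /\
  (forall c c', ~~ bad k c w -> ~~ bad k c' w -> next_box c c' -> core_conn k c c').
Proof.
elim: k => [|k [IH1 IH2]].
  split=> [c _|c c']; first by split; [exists c|move=> v v' /= -> ->].
  rewrite /= !negbK => wc wc' /orP[]/eqP -> v v' /= -> ->; [exact: conn_right|exact: conn_up].
have bridge c1 c2 c3 : ~~ bad k c2 w -> core_conn k c1 c2 -> core_conn k c2 c3 -> core_conn k c1 c3.
  move=> g2 K12 K23 v v' cv cv'; have [[v2 cv2] _] := IH1 _ g2.
  by apply: (conn_trans (K12 _ _ cv cv2)); exact: K23.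
have one_bad c c1 c2 : ~~ bad k.+1 c w -> c1 \in children c -> c2 \in children c ->
    bad k c1 w -> bad k c2 w -> c1 = c2.
  move=> gc c1c c2c b1 b2; apply/eqP; apply: contraNT gc => c12.
  exact: bad_two b1 b2.
have S1 c : ~~ bad k.+1 c w -> (exists v, core k.+1 c v) /\ core_conn k.+1 c c.
  move=> gc.
  (* [b] is the bad child if there is one, and otherwise a point off the grid, so that in both cases
     the good children are the cells other than [b]. *)
  have [b bg gb] : exists2 b, b \in (3, 3)%N :: grid &
      forall x, x \in grid -> (x != b) = ~~ bad k (child c x) w.
    have [/hasP[b bg bb]|/hasPn H] := boolP (has (fun x => bad k (child c x) w) grid).
      exists b; first by rewrite in_cons bg orbT.
      move=> x xg; apply/idP/idP; last by apply: contra => /eqP ->.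
      apply: contra => bx; apply/eqP.
      have := one_bad c _ _ gc (child_in c xg) (child_in c bg) bx bb.
      by case: x b {xg bg bb bx} => [x1 x2] [b1 b2] [/addnI /= -> /addnI /= ->].
    exists (3, 3)%N; first by rewrite mem_head.
    move=> x xg; rewrite H//; apply/eqP => E0; move: xg; rewrite E0.
    by vm_compute.
  have grown n x z : x \in grid -> x != b -> z \in iter n (grow b) [:: x] ->
      [/\ z \in grid, z != b & core_conn k (child c x) (child c z)].
    move=> xg xb; elim: n z => [|n IHn] z.
      by rewrite inE => /eqP ->; split => //; have [] := IH1 (child c x); rewrite -?gb.
    rewrite iterS mem_filter => /andP[/orP[/IHn//|/andP[zb /hasP[y /IHn[yg yb Kxy] yz]]] zg].
    split => //; apply: bridge Kxy _; first by rewrite -gb.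
    have gy : ~~ bad k (child c y) w by rewrite -gb.
    have gz : ~~ bad k (child c z) w by rewrite -gb.
    have next_child u u' : next_box u u' -> next_box (child c u) (child c u').
      by rewrite /next_box /child => /orP[]/eqP ->; rewrite /= !addnS eqxx ?orbT.
    by case/orP: yz => /next_child yz; [exact: IH2|apply: core_connC; exact: IH2].
  split.
    have [x xg xb] : exists2 x, x \in grid & x != b.
      by case: (eqVneq (0, 0)%N b) => [<-|]; [exists (0, 1)%N|exists (0, 0)%N].
    have [[v cv] _] := IH1 (child c x) (etrans (esym (gb x xg)) xb).
    exists v => /=; exists (child c x); split => //; last by rewrite -gb.
    exact: child_in.
  move=> v v' /= [c1 [/childP[x xg ->] g1 cv]] [c2 [/childP[y yg ->] g2 cv']].
  have xb : x != b by rewrite gb.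
  have yb : y != b by rewrite gb.
  by have [_ _] := grown _ _ _ xg xb (grid_connected bg xg yg xb yb); apply.
split=> // c c' gc gc' cc'.
suff [x [y [xc yc gx gy xy]]] : exists x y, [/\ x \in children c, y \in children c',
    ~~ bad k x w, ~~ bad k y w & next_box x y].
  move=> v v' cv cv'; have [[u cu] _] := IH1 _ gx; have [[u' cu'] _] := IH1 _ gy.
  apply: (conn_trans (y := site u)).
    by have [_] := S1 _ gc; apply => //; exists x.
  apply: (conn_trans (y := site u')); first by apply: IH2 cu cu'.
  by have [_] := S1 _ gc'; apply => //; exists y.
(* Pigeonhole: were each of the three facing pairs spoiled, two of the bad children would lie in the
   same box. *)
have side (f g : nat -> pt) : (forall j, (j < 3)%N -> f j \in children c) ->
    (forall j, (j < 3)%N -> g j \in children c') -> injective f -> injective g ->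
    (forall j, next_box (f j) (g j)) ->
    exists x y, [/\ x \in children c, y \in children c', ~~ bad k x w, ~~ bad k y w & next_box x y].
  move=> fc gc0 fi gi fg; apply: contrapT => H.
  have Hj j : (j < 3)%N -> bad k (f j) w \/ bad k (g j) w.
    move=> j3; have [bf|gf] := boolP (bad k (f j) w); first by left.
    right; apply: contrapT => /negP bg; apply: H; exists (f j), (g j); split => //; auto.
  have ff i j : (i < 3)%N -> (j < 3)%N -> bad k (f i) w -> bad k (f j) w -> i = j.
    by move=> i3 j3 bi bj; apply: fi; apply: (one_bad c); auto.
  have gg i j : (i < 3)%N -> (j < 3)%N -> bad k (g i) w -> bad k (g j) w -> i = j.
    by move=> i3 j3 bi bj; apply: gi; apply: (one_bad c'); auto.
  have f01 := ff 0%N 1%N isT isT; have f02 := ff 0%N 2%N isT isT; have f12 := ff 1%N 2%N isT isT.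
  have g01 := gg 0%N 1%N isT isT; have g02 := gg 0%N 2%N isT isT; have g12 := gg 1%N 2%N isT isT.
  have [b0|b0] := Hj 0%N isT; have [b1|b1] := Hj 1%N isT; have [b2|b2] := Hj 2%N isT;
  by [have := f01 b0 b1|have := f02 b0 b2|have := f12 b1 b2|
      have := g01 b0 b1|have := g02 b0 b2|have := g12 b1 b2].
case/orP: cc' => /eqP E0.
  apply: (side (fun j => ((3 * c.1 + 2)%N, (3 * c.2 + j)%N)) (fun j => ((3 * c'.1)%N, (3 * c'.2 + j)%N))).
  - by move=> j j3; rewrite mem_children /parent; case: c {gc gc' E0 side} => a b /=; apply/eqP; congr pair; lia.
  - by move=> j j3; rewrite mem_children /parent; case: c' {gc gc' E0 side} => a b /=; apply/eqP; congr pair; lia.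
  - by move=> i j [/addnI].
  - by move=> i j [/addnI].
  - by move=> j; rewrite E0 /next_box /=; apply/orP; left; apply/eqP; congr pair; lia.
apply: (side (fun j => ((3 * c.1 + j)%N, (3 * c.2 + 2)%N)) (fun j => ((3 * c'.1 + j)%N, (3 * c'.2)%N))).
- by move=> j j3; rewrite mem_children /parent; case: c {gc gc' E0 side} => a b /=; apply/eqP; congr pair; lia.
- by move=> j j3; rewrite mem_children /parent; case: c' {gc gc' E0 side} => a b /=; apply/eqP; congr pair; lia.
- by move=> i j [/addnI].
- by move=> i j [/addnI].
- by move=> j; rewrite E0 /next_box /=; apply/orP; right; apply/eqP; congr pair; lia.
Qed.

Lemma core_far k c v : core k c v -> (3 ^ k * c.1 <= v.1)%N.
Proof.
elim: k c => [|k IH] c /=; first by move=> ->; lia.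
move=> [c' [+ _ /IH]]; rewrite mem_children /parent => /eqP <- /=.
by apply: leq_trans; rewrite expnSr -mulnA leq_mul2l; apply/orP; right; lia.
Qed.

Lemma core_origin k : (forall k, ~~ bad k (0, 0)%N w) -> core k (0, 0)%N (0, 0)%N.
Proof.
by move=> H; elim: k => //= k IH; exists (0, 0)%N; split; rewrite ?mem_children.
Qed.

(** In the good box of level [k.+1] at the origin, the children [(1, 0)] and [(1, 1)] are not both
    bad. The core of a good one lies at distance at least [3 ^ k] to the right, and the connected
    core of the large box joins it to the origin. *)
Lemma origin_far k : (forall k, ~~ bad k (0, 0)%N w) ->
  exists2 v, conn (site (0, 0)%N) (site v) & (k <= v.1)%N.
Proof.
move=> H; have [S1 _] := core_connected k; have [T1 _] := core_connected k.+1.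
have [c' c'c [gc' c'1]] : exists2 c', c' \in children (0, 0)%N & ~~ bad k c' w /\ (1 <= c'.1)%N.
  have [b1|] := boolP (bad k (1, 0)%N w); last by exists (1, 0)%N; rewrite ?mem_children.
  have [b2|] := boolP (bad k (1, 1)%N w); last by exists (1, 1)%N; rewrite ?mem_children.
  have := H k.+1; rewrite (@bad_two k (0, 0)%N (1, 0)%N (1, 1)%N) ?mem_children//.
have [[v cv] _] := S1 _ gc'; exists v.
  have [_] := T1 _ (H k.+1); apply; first exact: (core_origin k.+1).
  by exists c'.
apply: leq_trans (core_far cv); apply: (@leq_trans (3 ^ k)); first by rewrite ltnW// ltn_expl.
by rewrite leq_pmulr.
Qed.

End geometry.
End boxes.

(** * Percolation of nearest neighbours in a coordinate quadrant *)

Section planar_percolation.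
Context {R : realType} {d : nat}.
Local Notation V := 'rV[int]_d.
Local Notation pt := (nat * nat)%type.
Variables (J : V -> R) (i0 i1 : 'I_d).
Hypothesis i01 : i0 != i1.
Hypothesis J_ge0 : forall x, 0 <= J x.
Hypothesis J_sym : symmetric_kernel J.

Definition plane_site (v : pt) : V := unit_vec i0 *+ v.1 + unit_vec i1 *+ v.2.

Lemma plane_site0 v : plane_site v 0 i0 = v.1%:Z.
Proof.
rewrite mxE !mulmxnE !mxE !eqxx (negbTE i01) /=.
by rewrite mul0rn addr0; exact: natz.
Qed.

Lemma plane_site1 v : plane_site v 0 i1 = v.2%:Z.
Proof.
rewrite mxE !mulmxnE !mxE !eqxx [i1 == i0]eq_sym (negbTE i01) /=.
by rewrite mul0rn add0r; exact: natz.
Qed.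

Lemma plane_site_inj : injective plane_site.
Proof.
move=> [a b] [a' b'] H.
have := plane_site0 (a, b); have := plane_site1 (a, b).
by rewrite H plane_site0 plane_site1 /= => -[->] [->].
Qed.

Lemma right_neq v : plane_site v != plane_site (v.1.+1, v.2).
Proof. by apply/eqP => /plane_site_inj; case: v => a b [] /=; lia. Qed.

Lemma up_neq v : plane_site v != plane_site (v.1, v.2.+1).
Proof. by apply/eqP => /plane_site_inj; case: v => a b [] /=; lia. Qed.

(** Each quadrant edge is listed at its lower or left end, hence at one site only; this makes
    disjoint boxes independent. *)
Definition plane_edges (v : pt) : seq (edge d) :=
  [:: sval (edge_at (right_neq v)); sval (edge_at (up_neq v))].

Lemma plane_edgesP v e : e \in plane_edges v ->
  val e = [fset plane_site v; plane_site (v.1.+1, v.2)]%fset \/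
  val e = [fset plane_site v; plane_site (v.1, v.2.+1)]%fset.
Proof.
rewrite !inE => /orP[]/eqP ->.
  by left; exact: (svalP (edge_at (right_neq v))).
by right; exact: (svalP (edge_at (up_neq v))).
Qed.

Lemma plane_edges_inj v v' e : e \in plane_edges v -> e \in plane_edges v' -> v = v'.
Proof.
case: v v' => [a b] [a' b'] /plane_edgesP H /plane_edgesP H'.
have cases : forall x y : pt, val e = [fset plane_site (a, b); plane_site x]%fset ->
    val e = [fset plane_site (a', b'); plane_site y]%fset ->
    ((a, b) = (a', b') /\ x = y) \/ ((a, b) = y /\ x = (a', b')).
  move=> x y -> /fset2_inj[[/plane_site_inj ? /plane_site_inj ?]|[/plane_site_inj ? /plane_site_inj ?]];
  by auto.
case: H => /cases H; case: H' => /H {cases H} /= [[E1 E2]|[E1 E2]];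
  move: E1 E2 => [? ?] [? ?]; congr pair; lia.
Qed.

Lemma plane_edge_weight v e : e \in plane_edges v -> 1 <= edge_weight (add_nn J) e.
Proof.
have nnN := symmetric_kernelN (add_nn_symmetric J_sym).
have nn1 i : 1 <= add_nn J (- unit_vec i).
  by rewrite /add_nn enormN enorm_unit_vec eqxx lerDr.
move=> /plane_edgesP[] E; rewrite (edge_weightE nnN E).
  have -> : plane_site v - plane_site (v.1.+1, v.2) = - unit_vec i0; last exact: nn1.
  by rewrite /plane_site mulrS /=; apply/rowP => j; rewrite !mxE; ring.
have -> : plane_site v - plane_site (v.1, v.2.+1) = - unit_vec i1; last exact: nn1.
by rewrite /plane_site mulrS /=; apply/rowP => j; rewrite !mxE; ring.
Qed.

Lemma beta_c_add_nn_fin : (beta_c (add_nn J) < +oo)%E.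
Proof.
have nn_sym := add_nn_symmetric J_sym.
have nn0 x : 0 <= add_nn J x by apply: le_trans (add_nn_ge J x).
(* Quadrant edges have weight at least 1, so each is closed with probability at most [1 / 1001],
   below the threshold [1 / 648]. *)
pose beta : R := 1000; have beta0 : 0 <= beta by rewrite /beta; lra.
set P := percolation beta (add_nn J).
pose p (e : edge d) : R := 1 - expR (- (beta * edge_weight (add_nn J) e)).
have PB : bernoulli_law P p := bernoulli_percolation (percolationP beta0 nn0 nn_sym).
have p01 e : 0 <= p e <= 1.
  rewrite /p subr_ge0 lerBlDr lerDl expR_ge0 andbT -expR0 ler_expR oppr_le0.
  by apply: mulr_ge0 => //; exact: nn0.
have p_plane v e : e \in plane_edges v -> 1 - p e <= 1 / 648.
  move=> /plane_edge_weight e1; rewrite /p opprB addrC subrK.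
  rewrite expRN; have := expR_ge1Dx (beta * edge_weight (add_nn J) e).
  set x := expR _ => Hx; have x648 : 648 <= x.
    by apply: le_trans Hx; rewrite /beta; nra.
  by rewrite -[_^-1]mul1r ler_pM2l// lef_pV2 ?posrE; lra.
pose bad_at k := [set w : config (edge d) | bad plane_edges k (0, 0)%N w].
pose s k := undup (flatten [seq plane_edges v | v <- box k (0, 0)%N]).
have s_cover k v : ancestor k v = (0, 0)%N -> {subset plane_edges v <= s k}.
  move=> /mem_box vb e ev; rewrite mem_undup; apply/flattenP.
  by exists (plane_edges v) => //; exact: map_f.
have us k : uniq (s k) by exact: undup_uniq.
have badE k : bad_at k = [set w | is_true (bad plane_edges k (0, 0)%N (restrict (s k) w))].
  apply/seteqP; split => w /=; rewrite /bad_at /= (@bad_local _ _ k _ w (restrict (s k) w))// => v vk e ev;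
  by rewrite /restrict (s_cover _ _ vk).
have mbad k : measurable (bad_at k).
  rewrite badE; exact: (measurable_restrict (fun w => is_true (bad plane_edges k (0, 0)%N w)) (us k)).
have Pbad k : (P (bad_at k) <= ((1 / 81) * (1 / 2) ^+ k)%:E)%E.
  rewrite badE.
  have -> := probability_restrict PB (fun w => is_true (bad plane_edges k (0, 0)%N w)) (us k).
  rewrite lee_fin; apply: (@le_trans _ _ (bad_bound (1 / 648) k)); last first.
    by apply: bad_bound_le; lra.
  have -> : expect p (s k) (fun w => ind (bad plane_edges k (0, 0)%N w)) =
      expect p (s k) (fun w => (bad plane_edges k (0, 0)%N w)%:R).
    by apply: eq_expect => w _; rewrite /ind asboolb.
  apply: bad_probability => //; [exact: plane_edges_inj|exact: s_cover].
pose good : set (config (edge d)) := ~` \bigcup_k bad_at k.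
have mU : measurable (\bigcup_k bad_at k) by exact: bigcupT_measurable.
(* Only the boxes at the origin, one for each level, have to be good simultaneously, so a union
   bound suffices. *)
have PU : (P (\bigcup_k bad_at k) <= (2 / 81)%:E)%E.
  apply: (@le_trans _ _ (\sum_(k <oo) P (bad_at k))%E).
    exact: measure_sigma_subadditive.
  apply: lime_le; first exact: is_cvg_nneseries.
  apply: nearW => n; apply: (@le_trans _ _ (\sum_(0 <= k < n) ((1 / 81) * (1 / 2) ^+ k)%:E)%E).
    by apply: lee_sum => k _; exact: Pbad.
  rewrite sumEFin lee_fin -mulr_sumr; have := @sum_half_le2 R n; lra.
have Pgood : (0 < P good)%E.
  rewrite /good probability_setC//.
  apply: (@lt_le_trans _ _ (1 - (2 / 81)%:E)%E).
    by rewrite -EFinB lte_fin; lra.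
  exact: leeB.
apply: (@le_lt_trans _ _ beta%:E); last exact: ltry.
apply: ereal_inf_lbound; exists beta => //; split => //.
apply: (lt_le_trans Pgood); apply: le_measure; rewrite ?inE.
- exact: measurableC.
- exact: measurable_infinite_cluster.
move=> w gw.
have gk k : ~~ bad plane_edges k (0, 0)%N w.
  by apply/negP => bk; apply: gw; exists k.
have site00 : plane_site (0, 0)%N = 0 by rewrite /plane_site !mulr0n addr0.
have open_edge (v v' : V) e : val e = [fset v; v']%fset -> (w : edge d -> bool) e -> open_cluster w v v'.
  by move=> E we; apply: cluster_step; rewrite (is_openE _ E).
have far_site n : exists2 v, open_cluster w 0 (plane_site v) & (n <= v.1)%N.
  rewrite -site00; apply: (@origin_far _ plane_edges _ (open_cluster w) plane_site w) => //.
  - exact: cluster_refl.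
  - by move=> x y; exact: cluster_sym.
  - by move=> x y z; exact: cluster_trans.
  - by move=> v /andP[wv _]; apply: open_edge wv; exact: (svalP (edge_at (right_neq v))).
  - by move=> v /and3P[_ wv _]; apply: open_edge wv; exact: (svalP (edge_at (up_neq v))).
move=> /finite_seqP[l El].
have [v ov nv] := far_site (\max_(x <- l) (absz (x 0%R i0))).+1.
have vl : plane_site v \in l by have : open_cluster w 0 (plane_site v) by []; rewrite El.
move: nv; rewrite (big_rem _ vl)/= plane_site0 absz_nat; lia.
Qed.

End planar_percolation.

Unset Implicit Arguments.

Theorem proposition1p11 (R : realType) (d : nat) (J : 'rV[int]_d -> R)
  (hd : (0 < d)%N)
  (J_ge0 : forall x, 0 <= J x)
  (J_int : integrable_kernel J)
  (J_sym : symmetric_kernel J)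
  (J_comp : exists a A : R, [/\ 0 < a, a < A &
     exists r : R, forall x : 'rV[int]_d, r <= enorm R x -> forall i : 'I_d,
       [/\ 0 < a * J (x + unit_vec i),
           a * J (x + unit_vec i) <= J x &
           J x <= A * J (x + unit_vec i)]])
  (hfin : d = 1%N -> (beta_c J < +oo)%E) :
  (beta_c (add_nn J) < beta_c J)%E.
Proof.
(* Positivity excludes [-oo] and feeds the finite case. If the value is [+oo], then [hfin] rules out
   dimension one and it remains to see that [add_nn J] percolates at some finite [beta]. *)
have := beta_c_gt0 J_ge0 J_int J_sym.
case Jc : (beta_c J) => [b| |] // b0.
  by rewrite -Jc; apply: (beta_c_lt_add_nn (Ordinal hd) J_ge0 J_int J_sym J_comp Jc).
have d1 : (1 < d)%N.
  rewrite ltn_neqAle hd andbT eq_sym; apply/eqP => /hfin.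
  by rewrite Jc ltxx.
exact: (@beta_c_add_nn_fin _ _ _ (Ordinal hd) (Ordinal d1)).
Qed.
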